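(* (i) For each of the graphs $CS1$, $CS2$, $B21$, $B22$ below, a $G$ design of order $n$ exists whenever $n \equiv 1 \pmod{39}$. (ii) For the flower snark $J7$ below, a $J7$ design of order $n$ exists whenever $n \equiv 1$ or $28 \pmod{84}$. (iii) For the double star snark $DS$ below, a $DS$ design of order $n$ exists whenever $n \equiv 1 \pmod{45}$. (iv) For each of $B31$, $B32$ below, a $G$ design of order $n$ exists whenever $n \equiv 1 \pmod{51}$. (v) For Zamfirescu's graph $Z$ below, a $Z$ design of order $n$ exists whenever $n \equiv 1 \pmod{108}$. (vi) For Goldberg's snark \#5, $GS5$ below, a $GS5$ design of order $n$ exists whenever $n \equiv 1$ or $40 \pmod{120}$. (vii) For each of the Szekeres snark $Sze$ and the Watkins snark $Wat$ below, a $G$ design of order $n$ exists whenever $n \equiv 1 \pmod{75}$. The graphs (vertex set $\{1,\dots,v\}$, given by edge sets): $CS1$ (Celmins–Swart \#1, $v=26$): $\{1,2\},\{1,4\},\{1,10\},\{2,6\},\{2,8\},\{3,4\},\{3,5\},\{3,8\},\{4,7\},\{5,6\},\{5,12\},\{6,7\},\{7,9\},\{8,11\},\{9,10\},\{9,14\},\{10,18\},\{11,15\},\{11,16\},\{12,13\},\{12,16\},\{13,14\},\{13,15\},\{14,17\},\{15,22\},\{16,19\},\{17,18\},\{17,21\},\{18,26\},\{19,23\},\{19,25\},\{20,21\},\{20,22\},\{20,25\},\{21,24\},\{22,23\},\{23,24\},\{24,26\},\{25,26\}$. $CS2$ (Celmins–Swart \#2, $v=26$): $\{1,6\},\{1,2\},\{3,4\},\{3,7\},\{2,4\},\{3,5\},\{5,6\},\{1,7\},\{7,20\},\{8,9\},\{8,17\},\{9,10\},\{4,10\},\{10,14\},\{6,11\},\{11,12\},\{12,13\},\{12,16\},\{9,13\},\{13,18\},\{14,15\},\{14,19\},\{2,15\},\{15,26\},\{8,16\},\{16,21\},\{11,17\},\{17,18\},\{18,19\},\{19,24\},\{20,25\},\{21,22\},\{5,22\},\{22,23\},\{20,23\},\{23,24\},\{24,26\},\{21,25\},\{25,26\}$.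 $B21$ ($v=26$): $\{1,3\},\{1,4\},\{2,3\},\{2,6\},\{3,5\},\{4,6\},\{4,8\},\{5,7\},\{5,8\},\{6,7\},\{7,9\},\{8,10\},\{9,11\},\{9,12\},\{10,11\},\{10,14\},\{11,13\},\{12,14\},\{12,16\},\{13,15\},\{13,16\},\{14,15\},\{15,17\},\{16,18\},\{17,19\},\{17,20\},\{18,19\},\{18,22\},\{19,21\},\{20,22\},\{20,24\},\{21,23\},\{21,24\},\{22,23\},\{23,25\},\{24,26\},\{1,25\},\{2,26\},\{25,26\}$. $B22$ ($v=26$): $\{1,3\},\{1,4\},\{2,3\},\{2,6\},\{4,8\},\{5,7\},\{5,8\},\{6,7\},\{7,9\},\{8,10\},\{9,11\},\{9,12\},\{10,11\},\{10,14\},\{11,13\},\{12,14\},\{12,16\},\{13,15\},\{13,16\},\{14,15\},\{15,17\},\{16,18\},\{17,19\},\{17,20\},\{18,19\},\{18,22\},\{19,21\},\{20,22\},\{20,24\},\{21,23\},\{21,24\},\{22,23\},\{23,1\},\{24,2\},\{3,25\},\{4,26\},\{5,25\},\{6,26\},\{25,26\}$. $J7$ ($v=28$): $\{1,2\},\{1,3\},\{1,4\},\{2,5\},\{2,6\},\{3,7\},\{3,8\},\{4,9\},\{4,10\},\{5,11\},\{5,12\},\{6,13\},\{6,14\},\{7,11\},\{7,13\},\{8,15\},\{8,16\},\{9,12\},\{9,14\},\{10,17\},\{10,18\},\{11,19\},\{12,20\},\{13,21\},\{14,22\},\{15,17\},\{15,23\},\{16,19\},\{16,21\},\{17,24\},\{18,20\},\{18,22\},\{19,25\},\{20,26\},\{21,27\},\{22,28\},\{23,25\},\{23,27\},\{24,26\},\{24,28\},\{25,28\},\{26,27\}$.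 $DS$ ($v=30$): $\{13,16\},\{15,16\},\{12,15\},\{16,19\},\{15,18\},\{23,25\},\{25,29\},\{28,29\},\{25,26\},\{29,30\},\{21,24\},\{21,22\},\{22,27\},\{17,21\},\{20,22\},\{10,14\},\{9,10\},\{9,11\},\{7,10\},\{4,9\},\{5,6\},\{2,6\},\{1,2\},\{6,8\},\{2,3\},\{14,19\},\{7,13\},\{5,26\},\{8,23\},\{13,17\},\{19,24\},\{7,23\},\{14,26\},\{8,24\},\{5,17\},\{1,18\},\{12,30\},\{20,28\},\{4,27\},\{3,11\},\{18,28\},\{27,30\},\{11,20\},\{1,4\},\{3,12\}$. $B31$ ($v=34$): $\{1,3\},\{1,4\},\{2,3\},\{2,6\},\{3,5\},\{4,6\},\{4,8\},\{5,7\},\{5,8\},\{6,7\},\{7,9\},\{8,10\},\{9,11\},\{9,12\},\{10,11\},\{10,14\},\{11,13\},\{12,14\},\{12,16\},\{13,15\},\{13,16\},\{14,15\},\{15,17\},\{16,18\},\{17,19\},\{17,20\},\{18,19\},\{18,22\},\{19,21\},\{20,22\},\{20,24\},\{21,23\},\{21,24\},\{22,23\},\{23,25\},\{24,26\},\{25,27\},\{25,28\},\{26,27\},\{26,30\},\{27,29\},\{28,30\},\{28,32\},\{29,31\},\{29,32\},\{30,31\},\{31,33\},\{32,34\},\{33,1\},\{34,2\},\{33,34\}$. $B32$ ($v=34$): $\{1,3\},\{1,4\},\{2,3\},\{2,6\},\{4,8\},\{5,7\},\{5,8\},\{6,7\},\{7,9\},\{8,10\},\{9,11\},\{9,12\},\{10,11\},\{10,14\},\{11,13\},\{12,14\},\{12,16\},\{13,15\},\{13,16\},\{14,15\},\{15,17\},\{16,18\},\{17,19\},\{17,20\},\{18,19\},\{18,22\},\{19,21\},\{20,22\},\{20,24\},\{21,23\},\{21,24\},\{22,23\},\{23,25\},\{24,26\},\{25,27\},\{25,28\},\{26,27\},\{26,30\},\{27,29\},\{28,30\},\{28,32\},\{29,31\},\{29,32\},\{30,31\},\{31,1\},\{32,2\},\{3,33\},\{4,34\},\{5,33\},\{6,34\},\{33,34\}$.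 $Z$ ($v=36$): $\{1,2\},\{2,3\},\{3,4\},\{4,5\},\{5,6\},\{6,7\},\{7,8\},\{8,9\},\{9,1\},\{3,8\},\{6,2\},\{9,5\},\{10,11\},\{11,12\},\{12,13\},\{13,14\},\{14,15\},\{15,16\},\{16,17\},\{17,18\},\{18,10\},\{12,17\},\{15,11\},\{18,14\},\{19,20\},\{20,21\},\{21,22\},\{22,23\},\{23,24\},\{24,25\},\{25,26\},\{26,27\},\{27,19\},\{21,26\},\{24,20\},\{27,23\},\{28,29\},\{29,30\},\{30,31\},\{31,32\},\{32,33\},\{33,34\},\{34,35\},\{35,36\},\{36,28\},\{30,35\},\{33,29\},\{36,32\},\{1,10\},\{4,19\},\{7,28\},\{16,22\},\{25,31\},\{34,13\}$. $GS5$ ($v=40$): $\{15,16\},\{14,15\},\{15,21\},\{21,26\},\{25,26\},\{26,27\},\{16,27\},\{14,25\},\{7,10\},\{2,6\},\{6,10\},\{4,6\},\{3,4\},\{3,7\},\{1,3\},\{1,2\},\{9,17\},\{5,8\},\{8,9\},\{8,11\},\{11,13\},\{13,17\},\{12,13\},\{5,12\},\{24,32\},\{28,29\},\{24,28\},\{28,30\},\{30,33\},\{32,33\},\{33,36\},\{29,36\},\{31,34\},\{38,40\},\{34,38\},\{37,38\},\{35,37\},\{31,35\},\{35,39\},\{39,40\},\{2,16\},\{7,25\},\{10,17\},\{1,5\},\{9,32\},\{12,29\},\{24,31\},\{36,40\},\{14,34\},\{27,39\},\{20,21\},\{4,18\},\{11,19\},\{22,30\},\{23,37\},\{19,22\},\{22,23\},\{20,23\},\{18,20\},\{18,19\}$.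 $Sze$ ($v=50$): $\{29,30\},\{27,29\},\{22,24\},\{21,22\},\{21,23\},\{23,25\},\{25,28\},\{28,30\},\{22,26\},\{25,26\},\{26,29\},\{23,27\},\{24,28\},\{3,6\},\{5,10\},\{1,3\},\{3,5\},\{1,12\},\{2,10\},\{4,6\},\{4,9\},\{9,12\},\{12,13\},\{6,13\},\{10,13\},\{2,4\},\{16,17\},\{19,20\},\{14,17\},\{17,19\},\{14,15\},\{8,20\},\{7,16\},\{7,11\},\{11,15\},\{15,18\},\{16,18\},\{18,20\},\{7,8\},\{35,44\},\{36,41\},\{43,44\},\{41,44\},\{31,43\},\{36,38\},\{34,35\},\{32,34\},\{31,32\},\{31,33\},\{33,35\},\{33,36\},\{34,38\},\{45,47\},\{39,42\},\{47,49\},\{42,47\},\{40,49\},\{39,50\},\{45,48\},\{46,48\},\{40,46\},\{37,40\},\{37,45\},\{37,39\},\{48,50\},\{30,41\},\{9,42\},\{11,21\},\{5,32\},\{19,46\},\{1,27\},\{2,14\},\{8,43\},\{38,49\},\{24,50\}$. $Wat$ ($v=50$): $\{1,2\},\{1,4\},\{1,15\},\{2,3\},\{2,8\},\{3,6\},\{3,37\},\{4,6\},\{4,7\},\{5,10\},\{5,11\},\{5,22\},\{6,9\},\{7,8\},\{7,12\},\{8,9\},\{9,14\},\{10,13\},\{10,17\},\{11,16\},\{11,18\},\{12,14\},\{12,33\},\{13,15\},\{13,16\},\{14,20\},\{15,21\},\{16,19\},\{17,18\},\{17,19\},\{18,30\},\{19,21\},\{20,24\},\{20,26\},\{21,50\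},\{22,23\},\{22,27\},\{23,24\},\{23,25\},\{24,29\},\{25,26\},\{25,28\},\{26,31\},\{27,28\},\{27,48\},\{28,29\},\{29,31\},\{30,32\},\{30,36\},\{31,36\},\{32,34\},\{32,35\},\{33,34\},\{33,40\},\{34,41\},\{35,38\},\{35,40\},\{36,38\},\{37,39\},\{37,42\},\{38,41\},\{39,44\},\{39,46\},\{40,46\},\{41,46\},\{42,43\},\{42,45\},\{43,44\},\{43,49\},\{44,47\},\{45,47\},\{45,48\},\{47,50\},\{48,49\},\{49,50\}$.
   Context: All graphs are simple. For a graph $G$, a $G$ design of order $n$ is a partition of the edge set of the complete graph $K_n$ into edge sets of subgraphs each isomorphic to $G$. By convention the empty set is a $G$ design of order $1$. *)

(* Defs.v *)
From mathcomp Require Import all_boot.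

Set Implicit Arguments.
Unset Strict Implicit.
Unset Printing Implicit Defensive.

(* A simple graph whose vertex set is a subset of the finite type T. *)
Record graph (T : finType) := Graph {
  vertices : {set T};
  edges : {set {set T}};
  edgesP : forall e, e \in edges -> (e \subset vertices) && (#|e| == 2)
}.

Lemma complete_subproof (n : nat) (e : {set 'I_n}) :
  e \in [set e : {set 'I_n} | #|e| == 2] ->
  (e \subset [set: 'I_n]) && (#|e| == 2).
Proof. by rewrite inE subsetT. Qed.

Definition complete (n : nat) : graph 'I_n := Graph (@complete_subproof n).

Definition subgraph (T : finType) (H K : graph T) : Prop :=
  vertices H \subset vertices K /\ edges H \subset edges K.

(* Only the values of f on the vertices of G matter. *)
Definition isomorphism (T U : finType) (G : graph T) (H : graph U)
    (f : T -> U) : Prop :=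
  [/\ {in vertices G &, injective f},
      f @: vertices G = vertices H
    & {in vertices G &, forall x y,
        ([set x; y] \in edges G) = ([set f x; f y] \in edges H)}].

Definition isomorphic (T U : finType) (G : graph T) (H : graph U) : Prop :=
  exists f : T -> U, isomorphism G H f.

Definition is_design (T : finType) (G : graph T) (n : nat)
    (D : {set {set {set 'I_n}}}) : Prop :=
  partition D (edges (complete n)) /\
  forall B : {set {set 'I_n}}, B \in D ->
    exists H : graph 'I_n,
      [/\ subgraph H (complete n), isomorphic G H & edges H = B].

Definition has_design (T : finType) (G : graph T) (n : nat) : Prop :=
  exists D : {set {set {set 'I_n}}}, is_design G D.

(* The convention that the empty set is a design of order 1 is a consequence
   of the definition. *)
Lemma empty_design (T : finType) (G : graph T) :
  is_design G (set0 : {set {set {set 'I_1}}}).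
Proof.
split=> [|B]; last by rewrite inE.
suff -> : edges (complete 1) = set0 by rewrite partition_set0.
apply/setP => e; rewrite !inE; apply/negbTE.
by rewrite neq_ltn (leq_ltn_trans (max_card _)) ?card_ord.
Qed.

Definition valid_edge (v : nat) (p : nat * nat) : bool :=
  [&& 0 < p.1 <= v, 0 < p.2 <= v & p.1 != p.2].

Section GraphOfList.

Variables (v : nat) (s : seq (nat * nat)).

(* The vertex set {1, ..., v} is carried by 'I_v.+1, with 0 left out. For a
   valid edge (a, b) neither inord below is out of range. *)
Definition list_vertices : {set 'I_v.+1} := [set i : 'I_v.+1 | 0 < i].

Definition list_edges : {set {set 'I_v.+1}} :=
  [set e in [seq [set inord p.1; inord p.2] | p <- s]].

Lemma graph_of_list_subproof : all (valid_edge v) s ->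
  forall e, e \in list_edges -> (e \subset list_vertices) && (#|e| == 2).
Proof.
move=> /allP sP e; rewrite inE => /mapP[[a b] /sP /= + ->].
case/and3P=> /= /andP[a0 av] /andP[b0 bv] ab.
rewrite cards2 -val_eqE /= !inordK // ab eqxx andbT.
by apply/subsetP => x; rewrite !inE => /orP[] /eqP->; rewrite inordK.
Qed.

Definition graph_of_list (ok : all (valid_edge v) s) : graph 'I_v.+1 :=
  Graph (graph_of_list_subproof ok).

End GraphOfList.

Definition CS1 : graph 'I_27 := @graph_of_list 26 [::
  (1,2); (1,4); (1,10); (2,6); (2,8); (3,4); (3,5); (3,8); (4,7); (5,6);
  (5,12); (6,7); (7,9); (8,11); (9,10); (9,14); (10,18); (11,15); (11,16);
  (12,13); (12,16); (13,14); (13,15); (14,17); (15,22); (16,19); (17,18);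
  (17,21); (18,26); (19,23); (19,25); (20,21); (20,22); (20,25); (21,24);
  (22,23); (23,24); (24,26); (25,26)] isT.

Definition CS2 : graph 'I_27 := @graph_of_list 26 [::
  (1,6); (1,2); (3,4); (3,7); (2,4); (3,5); (5,6); (1,7); (7,20); (8,9);
  (8,17); (9,10); (4,10); (10,14); (6,11); (11,12); (12,13); (12,16);
  (9,13); (13,18); (14,15); (14,19); (2,15); (15,26); (8,16); (16,21);
  (11,17); (17,18); (18,19); (19,24); (20,25); (21,22); (5,22); (22,23);
  (20,23); (23,24); (24,26); (21,25); (25,26)] isT.

Definition B21 : graph 'I_27 := @graph_of_list 26 [::
  (1,3); (1,4); (2,3); (2,6); (3,5); (4,6); (4,8); (5,7); (5,8); (6,7);
  (7,9); (8,10); (9,11); (9,12); (10,11); (10,14); (11,13); (12,14);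
  (12,16); (13,15); (13,16); (14,15); (15,17); (16,18); (17,19); (17,20);
  (18,19); (18,22); (19,21); (20,22); (20,24); (21,23); (21,24); (22,23);
  (23,25); (24,26); (1,25); (2,26); (25,26)] isT.

Definition B22 : graph 'I_27 := @graph_of_list 26 [::
  (1,3); (1,4); (2,3); (2,6); (4,8); (5,7); (5,8); (6,7); (7,9); (8,10);
  (9,11); (9,12); (10,11); (10,14); (11,13); (12,14); (12,16); (13,15);
  (13,16); (14,15); (15,17); (16,18); (17,19); (17,20); (18,19); (18,22);
  (19,21); (20,22); (20,24); (21,23); (21,24); (22,23); (23,1); (24,2);
  (3,25); (4,26); (5,25); (6,26); (25,26)] isT.

Definition J7 : graph 'I_29 := @graph_of_list 28 [::
  (1,2); (1,3); (1,4); (2,5); (2,6); (3,7); (3,8); (4,9); (4,10); (5,11);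
  (5,12); (6,13); (6,14); (7,11); (7,13); (8,15); (8,16); (9,12); (9,14);
  (10,17); (10,18); (11,19); (12,20); (13,21); (14,22); (15,17); (15,23);
  (16,19); (16,21); (17,24); (18,20); (18,22); (19,25); (20,26); (21,27);
  (22,28); (23,25); (23,27); (24,26); (24,28); (25,28); (26,27)] isT.

Definition DS : graph 'I_31 := @graph_of_list 30 [::
  (13,16); (15,16); (12,15); (16,19); (15,18); (23,25); (25,29); (28,29);
  (25,26); (29,30); (21,24); (21,22); (22,27); (17,21); (20,22); (10,14);
  (9,10); (9,11); (7,10); (4,9); (5,6); (2,6); (1,2); (6,8); (2,3); (14,19);
  (7,13); (5,26); (8,23); (13,17); (19,24); (7,23); (14,26); (8,24); (5,17);
  (1,18); (12,30); (20,28); (4,27); (3,11); (18,28); (27,30); (11,20);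
  (1,4); (3,12)] isT.

Definition B31 : graph 'I_35 := @graph_of_list 34 [::
  (1,3); (1,4); (2,3); (2,6); (3,5); (4,6); (4,8); (5,7); (5,8); (6,7);
  (7,9); (8,10); (9,11); (9,12); (10,11); (10,14); (11,13); (12,14);
  (12,16); (13,15); (13,16); (14,15); (15,17); (16,18); (17,19); (17,20);
  (18,19); (18,22); (19,21); (20,22); (20,24); (21,23); (21,24); (22,23);
  (23,25); (24,26); (25,27); (25,28); (26,27); (26,30); (27,29); (28,30);
  (28,32); (29,31); (29,32); (30,31); (31,33); (32,34); (33,1); (34,2);
  (33,34)] isT.

Definition B32 : graph 'I_35 := @graph_of_list 34 [::
  (1,3); (1,4); (2,3); (2,6); (4,8); (5,7); (5,8); (6,7); (7,9); (8,10);
  (9,11); (9,12); (10,11); (10,14); (11,13); (12,14); (12,16); (13,15);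
  (13,16); (14,15); (15,17); (16,18); (17,19); (17,20); (18,19); (18,22);
  (19,21); (20,22); (20,24); (21,23); (21,24); (22,23); (23,25); (24,26);
  (25,27); (25,28); (26,27); (26,30); (27,29); (28,30); (28,32); (29,31);
  (29,32); (30,31); (31,1); (32,2); (3,33); (4,34); (5,33); (6,34); (33,34)] isT.

(* Zamfirescu's graph Z *)
Definition Zam : graph 'I_37 := @graph_of_list 36 [::
  (1,2); (2,3); (3,4); (4,5); (5,6); (6,7); (7,8); (8,9); (9,1); (3,8);
  (6,2); (9,5); (10,11); (11,12); (12,13); (13,14); (14,15); (15,16);
  (16,17); (17,18); (18,10); (12,17); (15,11); (18,14); (19,20); (20,21);
  (21,22); (22,23); (23,24); (24,25); (25,26); (26,27); (27,19); (21,26);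
  (24,20); (27,23); (28,29); (29,30); (30,31); (31,32); (32,33); (33,34);
  (34,35); (35,36); (36,28); (30,35); (33,29); (36,32); (1,10); (4,19);
  (7,28); (16,22); (25,31); (34,13)] isT.

Definition GS5 : graph 'I_41 := @graph_of_list 40 [::
  (15,16); (14,15); (15,21); (21,26); (25,26); (26,27); (16,27); (14,25);
  (7,10); (2,6); (6,10); (4,6); (3,4); (3,7); (1,3); (1,2); (9,17); (5,8);
  (8,9); (8,11); (11,13); (13,17); (12,13); (5,12); (24,32); (28,29);
  (24,28); (28,30); (30,33); (32,33); (33,36); (29,36); (31,34); (38,40);
  (34,38); (37,38); (35,37); (31,35); (35,39); (39,40); (2,16); (7,25);
  (10,17); (1,5); (9,32); (12,29); (24,31); (36,40); (14,34); (27,39);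
  (20,21); (4,18); (11,19); (22,30); (23,37); (19,22); (22,23); (20,23);
  (18,20); (18,19)] isT.

Definition Sze : graph 'I_51 := @graph_of_list 50 [::
  (29,30); (27,29); (22,24); (21,22); (21,23); (23,25); (25,28); (28,30);
  (22,26); (25,26); (26,29); (23,27); (24,28); (3,6); (5,10); (1,3); (3,5);
  (1,12); (2,10); (4,6); (4,9); (9,12); (12,13); (6,13); (10,13); (2,4);
  (16,17); (19,20); (14,17); (17,19); (14,15); (8,20); (7,16); (7,11);
  (11,15); (15,18); (16,18); (18,20); (7,8); (35,44); (36,41); (43,44);
  (41,44); (31,43); (36,38); (34,35); (32,34); (31,32); (31,33); (33,35);
  (33,36); (34,38); (45,47); (39,42); (47,49); (42,47); (40,49); (39,50);
  (45,48); (46,48); (40,46); (37,40); (37,45); (37,39); (48,50); (30,41);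
  (9,42); (11,21); (5,32); (19,46); (1,27); (2,14); (8,43); (38,49); (24,50)] isT.

Definition Wat : graph 'I_51 := @graph_of_list 50 [::
  (1,2); (1,4); (1,15); (2,3); (2,8); (3,6); (3,37); (4,6); (4,7); (5,10);
  (5,11); (5,22); (6,9); (7,8); (7,12); (8,9); (9,14); (10,13); (10,17);
  (11,16); (11,18); (12,14); (12,33); (13,15); (13,16); (14,20); (15,21);
  (16,19); (17,18); (17,19); (18,30); (19,21); (20,24); (20,26); (21,50);
  (22,23); (22,27); (23,24); (23,25); (24,29); (25,26); (25,28); (26,31);
  (27,28); (27,48); (28,29); (29,31); (30,32); (30,36); (31,36); (32,34);
  (32,35); (33,34); (33,40); (34,41); (35,38); (35,40); (36,38); (37,39);
  (37,42); (38,41); (39,44); (39,46); (40,46); (41,46); (42,43); (42,45);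
  (43,44); (43,49); (44,47); (45,47); (45,48); (47,50); (48,49); (49,50)] isT.

(* Main.v *)
Require Import Defs.
From mathcomp Require Import all_boot zify.

Set Implicit Arguments.
Unset Strict Implicit.
Unset Printing Implicit Defensive.

(* Let e be the number of edges of G. A triple system whose blocks are
   triangles can be inflated: replacing every point by e points and every
   triple by a G-decomposition of K_{e,e,e} reduces K_{et+q}, minus a hole
   K_q, to such graphs with smaller t, as soon as there is a group divisible
   design with block size 3 on t points whose groups are proper. These exist
   for all t outside {0, 1, 2, 4, 5}: the constructions of Bose and Skolem and
   a twisted variant settle odd t, and doubling reduces even t to t / 2, except
   for t = 8, 10. There remain finitely many decompositions for each G, which
   are all developed from a few base blocks under a cyclic group. *)

(** * Decompositions of a complete graph with a hole *)

(** The graphs are cubic, so a design of order [n] needs [3] to divide [n - 1] and [2 * e] to divide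
    [n * (n - 1)]; here [3] always divides [e]. For odd [e] every [n = e * t + 1] passes both tests,
    for even [e] ([J7], [Zam], [GS5]) only even [t] does. The recursion must then stay within even
    [t], so designs on an even number of points are required to have even groups. The residues 28
    and 40 are [w = 2 * e / 3]: as [2 * e = 3 * w], these orders are [e * t + w] with [t] even. The
    hole lets all groups be completed with the same [q] extra points. It is a single point for
    residue 1; for 28 and 40 it has [w] points and is filled last. Steiner triple systems would
    reach only [t] congruent to 1 or 3 modulo 6; groups of mixed sizes reach the rest. On 2, 4 or 5
    points no design with proper groups (even ones, if [t] is even) exists, so these [t] need direct
    decompositions whenever they are admissible. *)

Section Decomposition.

Variables (T : finType) (G : graph T).

Definition copy (V : finType) (f : {ffun T -> V}) : {set {set V}} :=
  [set f @: (e : {set T}) | e in edges G].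

(** Blocks are maps rather than edge sets, so that they can be composed with embeddings. Injectivity
    is asked on the vertices only, because values elsewhere are arbitrary. *)
Definition decomposition (V : finType) (E : rel V)
    (B : {set {ffun T -> V}}) : Prop :=
  [/\ forall f, f \in B -> {in vertices G &, injective f},
      forall f, f \in B -> forall x y, [set x; y] \in copy f -> E x y,
      forall x y, x != y -> E x y ->
        exists2 f, f \in B & [set x; y] \in copy f
    & forall f g, f \in B -> g \in B -> forall x y,
        [set x; y] \in copy f -> [set x; y] \in copy g -> f = g].

(* Only the values of E off the diagonal matter. *)
Definition decomposable (V : finType) (E : rel V) : Prop :=
  exists B, decomposition E B.

Lemma card_copy (V : finType) (f : {ffun T -> V}) (e : {set V}) :
  {in vertices G &, injective f} -> e \in copy f -> #|e| = 2.
Proof.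
move=> fI /imsetP[d dG ->]; have /andP[/subsetP dV /eqP d2] := edgesP dG.
by rewrite card_in_imset // => x y /dV xV /dV yV; apply: fI.
Qed.

Lemma copy_neq (V : finType) (f : {ffun T -> V}) x y :
  {in vertices G &, injective f} -> [set x; y] \in copy f -> x != y.
Proof. by move=> fI /(card_copy fI); rewrite cards2; case: eqP. Qed.

Lemma decomposable0 (V : finType) : decomposable (fun _ _ : V => false).
Proof. by exists set0; split=> // f; rewrite inE. Qed.

Lemma eq_decomposable (V : finType) (E F : rel V) :
  (forall x y, x != y -> E x y = F x y) -> decomposable E -> decomposable F.
Proof.
move=> EF [B [BI BE BC BU]]; exists B; split=> // [f fB x y xyf|x y xy].
- rewrite -EF; [exact: BE xyf | exact: copy_neq (BI f fB) xyf].
- by rewrite -EF //; apply: BC.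
Qed.

Lemma decomposable_bigcup (J V : finType) (E : rel V) (F : J -> rel V) :
    (forall j, decomposable (F j)) ->
    (forall x y, x != y -> E x y = [exists j, F j x y]) ->
    (forall x y j k, x != y -> F j x y -> F k x y -> j = k) ->
  decomposable E.
Proof.
move=> /fin_all_exists[B BF] EF Funiq; exists (\bigcup_j B j); split.
- by move=> f /bigcupP[j _ fB]; case: (BF j) => + _ _ _; apply.
- move=> f /bigcupP[j _ fB] x y xyf; have [BI BE _ _] := BF j.
  rewrite EF; first by apply/existsP; exists j; apply: BE xyf.
  exact: copy_neq (BI f fB) xyf.
- move=> x y xy; rewrite EF // => /existsP[j Fxy].
  have [_ _ /(_ x y xy Fxy)[f fB xyf] _] := BF j.
  by exists f => //; apply/bigcupP; exists j.
- move=> f g /bigcupP[j _ fB] /bigcupP[k _ gB] x y xyf xyg.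
  have [jI jE _ jU] := BF j; have [kI kE _ _] := BF k.
  have jk : j = k.
    apply: Funiq (jE f fB _ _ xyf) (kE g gB _ _ xyg).
    exact: copy_neq (jI f fB) xyf.
  by rewrite -jk in gB; apply: jU xyf xyg.
Qed.

Lemma decomposable_image (V W : finType) (h : V -> W) (E : rel V) (F : rel W) :
    injective h ->
    (forall x y, x != y -> F (h x) (h y) = E x y) ->
    (forall u w, u != w -> F u w -> (u \in codom h) && (w \in codom h)) ->
  decomposable E -> decomposable F.
Proof.
move=> hI FE Fh [B [BI BE BC BU]].
pose lift (f : {ffun T -> V}) : {ffun T -> W} := [ffun t => h (f t)].
have copyE f x y : ([set h x; h y] \in copy (lift f)) = ([set x; y] \in copy f).
  have liftE (e : {set T}) : lift f @: e = h @: (f @: e).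
    by rewrite -imset_comp; apply: eq_imset => t /=; rewrite ffunE.
  have hE : [set h x; h y] = h @: [set x; y] by rewrite imsetU1 imset_set1.
  rewrite hE; apply/imsetP/imsetP => -[e eG xyE]; exists e => //.
    by apply: (imset_inj hI); rewrite xyE liftE.
  by rewrite xyE liftE.
have liftI (f : {ffun T -> V}) : {in vertices G &, injective f} ->
    {in vertices G &, injective (lift f)}.
  by move=> fI s t sV tV; rewrite !ffunE => /hI; apply: fI.
(* Pulls an edge of a lifted copy back to an edge of the copy itself, so that the edge conditions
   can be checked in [V]. *)
have codomh f u w : f \in B -> [set u; w] \in copy (lift f) ->
    exists x, exists y, [/\ x != y, u = h x, w = h y & [set x; y] \in copy f].
  move=> fB uwf; have uw := copy_neq (liftI f (BI f fB)) uwf.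
  have [e eG uwE] := imsetP uwf.
  have : u \in lift f @: e by rewrite -uwE !inE eqxx.
  case/imsetP=> s se; rewrite ffunE => us.
  have : w \in lift f @: e by rewrite -uwE !inE eqxx orbT.
  case/imsetP=> t te; rewrite ffunE => wt.
  exists (f s), (f t); rewrite -copyE -us -wt; split=> //.
  by apply: contraNneq uw => st; rewrite us wt st.
exists (lift @: B); split.
- by move=> _ /imsetP[f fB ->]; apply/liftI/BI.
- move=> _ /imsetP[f fB ->] u w /(codomh f u w fB)[x [y [xy -> -> xyf]]].
  by rewrite FE //; apply: BE xyf.
- move=> u w uw Fuw; have /andP[/codomP[x ux] /codomP[y wy]] := Fh u w uw Fuw.
  rewrite ux wy in uw Fuw *.
  have xy : x != y by apply: contraNneq uw => ->.
  rewrite FE // in Fuw; have [f fB xyf] := BC x y xy Fuw.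
  by exists (lift f); [apply: imset_f | rewrite copyE].
- move=> _ _ /imsetP[f fB ->] /imsetP[g gB ->] u w.
  move=> /(codomh f u w fB)[x [y [xy -> -> xyf]]]; rewrite copyE => xyg.
  by rewrite (BU f g fB gB x y xyf xyg).
Qed.

Lemma imset_edge_inj (V : finType) (f : T -> V) (d e : {set T}) :
  {in vertices G &, injective f} -> d \subset vertices G ->
  e \subset vertices G -> f @: d = f @: e -> d = e.
Proof.
move=> fI.
suff half (a b : {set T}) : a \subset vertices G -> b \subset vertices G ->
    f @: a = f @: b -> a \subset b.
  by move=> dV eV de; apply/eqP; rewrite eqEsubset; apply/andP; split; apply: half.
move=> /subsetP aV /subsetP bV ab; apply/subsetP => x xa.
have : f x \in f @: b by rewrite -ab imset_f.
by case/imsetP=> y yb fxy; rewrite (fI x y (aV x xa) (bV y yb) fxy).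
Qed.

(** * Holes: independence of the carrier, filling, passage to designs *)

Definition holed (V : finType) (A : {set V}) : Prop :=
  decomposable [rel x y | ~~ ((x \in A) && (y \in A))].

(* K_n minus the edges of a K_q *)
Definition has_holed (n q : nat) : Prop :=
  exists (V : finType) (A : {set V}), [/\ #|V| = n, #|A| = q & holed A].

(** [has_holed] hides its carrier; this bijection allows any carrier and any hole of the right
    sizes. *)
Lemma card_bijection (V W : finType) (A : {set V}) (B : {set W}) :
    #|V| = #|W| -> #|A| = #|B| ->
  exists2 h : V -> W, injective h & forall x, (h x \in B) = (x \in A).
Proof.
move=> VW AB.
have [w0|W0] := pickP W; last first.
  have V0 (x : V) : False by move: (max_card (pred1 x)); rewrite card1 VW eq_card0.
  by exists (fun x => False_rect W (V0 x)) => x; case: (V0 x).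
(* With the hole listed first on both sides, the position of a point decides whether it lies in the
   hole. *)
pose s := enum A ++ enum (~: A); pose r := enum B ++ enum (~: B).
have su : uniq s.
  rewrite cat_uniq !enum_uniq /= andbT; apply/hasPn => x.
  by rewrite !mem_enum inE.
have ru : uniq r.
  rewrite cat_uniq !enum_uniq /= andbT; apply/hasPn => x.
  by rewrite !mem_enum inE.
have sz : size s = size r.
  by rewrite !size_cat -!cardE AB; congr addn; apply: (@addnI #|A|);
     rewrite {2}AB !cardsC.
have ms x : x \in s by rewrite mem_cat !mem_enum inE orbN.
pose h x := nth w0 r (index x s).
have szx x : index x s < size r by rewrite -sz index_mem.
exists h => [x y /eqP|x].
  rewrite nth_uniq // => /eqP /(congr1 (nth x s)).
  by rewrite !nth_index.
rewrite /h nth_cat /s index_cat mem_enum -cardE -AB.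
have szA : size (enum A) = #|A| by rewrite -cardE.
case: (boolP (x \in A)) => xA.
  have xlt : index x (enum A) < #|A| by rewrite -szA index_mem mem_enum.
  rewrite xlt -mem_enum mem_nth // -cardE -AB //.
rewrite szA -ltn_subRL subnn ltn0 addKn; apply/negbTE.
rewrite -in_setC -mem_enum mem_nth //.
have := szx x; rewrite size_cat /s index_cat mem_enum (negbTE xA) -!cardE AB.
by rewrite ltn_add2l.
Qed.

Lemma holed_transport (V W : finType) (A : {set V}) (B : {set W}) :
  #|V| = #|W| -> #|A| = #|B| -> holed A -> holed B.
Proof.
move=> VW /(card_bijection VW)[h hI hA].
apply: (decomposable_image hI) => [x y _|u w _ _] /=; first by rewrite !hA.
by rewrite !(inj_card_onto hI) // VW.
Qed.

Lemma has_holedP (V : finType) (A : {set V}) :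
  has_holed #|V| #|A| -> holed A.
Proof. by case=> W [B [WV BA]]; apply: holed_transport. Qed.

Lemma has_holed_full q : has_holed q q.
Proof.
exists 'I_q, [set: 'I_q]; rewrite cardsT card_ord; split=> //.
by apply: eq_decomposable (decomposable0 'I_q) => x y _ /=; rewrite !inE.
Qed.

Lemma has_holed1 n : has_holed n 1 -> has_holed n 0.
Proof.
case=> V [A [Vn A1 AE]]; exists V, set0; rewrite cards0; split=> //.
apply: eq_decomposable AE => x y xy /=; rewrite !inE /=.
have /cards1P[z ->] : #|A| == 1 by rewrite A1.
by rewrite !inE; apply: contra xy => /andP[/eqP-> /eqP->].
Qed.

Lemma has_holed_fill n q : has_holed n q -> has_holed q 0 -> has_holed n 0.
Proof.
case=> V [A [Vn Aq AE]] q0; exists V, set0; rewrite cards0; split=> //.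
(* [F true] collects the edges outside the hole, [F false] those inside it. *)
pose F (b : bool) : rel V := fun x y => b (+) ((x \in A) && (y \in A)).
apply: (@decomposable_bigcup _ _ _ F).
- case; first exact: eq_decomposable AE.
  have : holed (set0 : {set {x | x \in A}}).
    by apply: has_holedP; rewrite cards0 card_sig Aq.
  apply: (decomposable_image val_inj) => [[x xA] [y yA] _|u w _] /=.
    by rewrite /F /= xA yA !inE.
  move=> /andP[uA wA]; apply/andP.
  by split; apply/codomP; [exists (exist _ u uA) | exists (exist _ w wA)].
- by move=> x y _; rewrite /= !inE; apply/esym/existsP;
    exists (~~ ((x \in A) && (y \in A))); rewrite /F; case: (_ && _).
- by move=> x y [] [] _; rewrite /F; case: (_ && _).
Qed.

(** A partition has no empty part, so the copies must contain an edge; this is the role of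
    [edges G != set0]. *)
Lemma has_design_of_holed n :
  edges G != set0 -> has_holed n 0 -> has_design G n.
Proof.
move=> /set0Pn[e0 e0G] n0.
have [B [BI BE BC BU]] : holed (set0 : {set 'I_n}).
  by apply: has_holedP; rewrite cards0 card_ord.
exists [set copy f | f in B]; split; last first.
  move=> _ /imsetP[f fB ->].
  have HP e : e \in copy f -> (e \subset f @: vertices G) && (#|e| == 2).
    move=> ef; rewrite (card_copy (BI f fB) ef) eqxx andbT.
    have [d dG ->] := imsetP ef; have /andP[dV _] := edgesP dG.
    exact: imsetS.
  exists (Graph HP); split=> //.
    split=> /=; first exact: subsetT.
    by apply/subsetP => e /HP; rewrite inE => /andP[].
  exists f; split=> //=; first exact: BI.
  move=> x y xV yV; apply/idP/imsetP => [xyG|[e eG]].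
    by exists [set x; y]; rewrite // imsetU1 imset_set1.
  have -> : [set f x; f y] = f @: [set x; y] by rewrite imsetU1 imset_set1.
  have /andP[eV _] := edgesP eG.
  move/imset_edge_inj => -> //; first exact: BI.
  by apply/subsetP => z; rewrite !inE => /orP[] /eqP->.
apply/and3P; split.
- apply/eqP/setP => e; rewrite inE; apply/bigcupP/idP.
    by case=> _ /imsetP[f fB ->] /(card_copy (BI f fB)) /eqP.
  case/cards2P=> x [y [xy ->]].
  have [|f fB xyf] := BC x y xy; first by rewrite /= !inE.
  by exists (copy f) => //; apply: imset_f.
- apply/trivIsetP => _ _ /imsetP[f fB ->] /imsetP[g gB ->] fg.
  apply/pred0P => e /=; apply: contraNF fg => /andP[ef eg].
  have /eqP/cards2P[x [y [xy exy]]] := card_copy (BI f fB) ef.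
  by apply/eqP; congr copy; apply: (BU f g fB gB x y); rewrite -exy.
- apply/imsetP => -[f fB f0].
  by have := imset_f (fun e : {set T} => f @: e) e0G; rewrite -/(copy f) -f0 inE.
Qed.

End Decomposition.

(** * Developing base blocks *)

Lemma set2_eqP (V : finType) (x y u w : V) :
  reflect (x = u /\ y = w \/ x = w /\ y = u) ([set x; y] == [set u; w]).
Proof.
apply: (iffP eqP) => [xyuw|[[-> ->]|[-> ->]]] //; last by rewrite setUC.
have : x \in [set u; w] by rewrite -xyuw !inE eqxx.
have : y \in [set u; w] by rewrite -xyuw !inE eqxx orbT.
have : u \in [set x; y] by rewrite xyuw !inE eqxx.
have : w \in [set x; y] by rewrite xyuw !inE eqxx orbT.
rewrite !inE.
by move=> /orP[] /eqP ? /orP[] /eqP ? /orP[] /eqP ? /orP[] /eqP ?; subst; auto.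
Qed.

Lemma uniq_map_inj (S : eqType) (R : eqType) (F : S -> R) (r : seq S) :
  uniq (map F r) -> {in r &, injective F}.
Proof.
move=> Fu x y xr yr Fxy; apply/eqP; rewrite -(nth_index x xr) -(nth_index x yr).
have ix : index x r < size r by rewrite index_mem.
have iy : index y r < size r by rewrite index_mem.
suff -> : index x r = index y r by [].
apply/eqP; rewrite -(nth_uniq (F x) _ _ Fu) ?size_map //.
by rewrite !(nth_map x) // !nth_index // Fxy.
Qed.

(** * A cyclic group acting on several intervals *)

Section Shift.

Variables (m c : nat).
Hypothesis m_gt0 : 0 < m.

(* The cyclic group of order m acts on the residues of each of c consecutive
   intervals of length m and fixes all other points. *)
Definition shift (t p : nat) : nat :=
  if p < c * m then p %/ m * m + (p + t) %% m else p.

Lemma shiftE t a r : r < m -> a < c -> shift t (a * m + r) = a * m + (r + t) %% m.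
Proof.
move=> rm ac; rewrite /shift ifT; last by nia.
by rewrite divnMDl // divn_small // addn0 -addnA modnMDl.
Qed.

Lemma shift_fixed t p : c * m <= p -> shift t p = p.
Proof. by rewrite /shift ltnNge => ->. Qed.

Lemma shift_moving t p : (shift t p < c * m) = (p < c * m).
Proof.
have [pc|pc] := ltnP p (c * m); last by rewrite shift_fixed // ltnNge pc.
have ac : p %/ m < c by rewrite ltn_divLR.
rewrite {1}(divn_eq p m) shiftE ?ltn_pmod //.
by have := ltn_pmod (p %% m + t) m_gt0; nia.
Qed.

Lemma shift_lt t p n : c * m <= n -> p < n -> shift t p < n.
Proof.
move=> cn pn; have [pc|/(shift_fixed t)->//] := ltnP p (c * m).
by apply: leq_trans cn; rewrite shift_moving.
Qed.

Lemma eq_shift t u p : t = u %[mod m] -> shift t p = shift u p.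
Proof. by move=> tu; rewrite /shift -modnDmr tu modnDmr. Qed.

Lemma shiftD t u p : shift t (shift u p) = shift (u + t) p.
Proof.
have [pc|pc] := ltnP p (c * m); last by rewrite !shift_fixed.
have ac : p %/ m < c by rewrite ltn_divLR.
by rewrite (divn_eq p m) !shiftE ?ltn_pmod // modnDml addnA.
Qed.

Lemma shift0 p : shift 0 p = p.
Proof. by rewrite /shift addn0 -divn_eq if_same. Qed.

Lemma shift_id t p : t = 0 %[mod m] -> shift t p = p.
Proof. by move=> /eq_shift->; rewrite shift0. Qed.

Lemma shift_mod t p : p < c * m -> shift t p %% m = (p + t) %% m.
Proof. by rewrite /shift => ->; rewrite modnMDl modn_mod. Qed.

Lemma shift_div t p : p < c * m -> shift t p %/ m = p %/ m.
Proof.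
by rewrite /shift => ->; rewrite divnMDl // [_ %% _ %/ _]divn_small ?ltn_pmod // addn0.
Qed.

Lemma shift_inj t : injective (shift t).
Proof.
(* [m * t - t] is a natural number opposite to [t] modulo [m]. *)
move=> p q pq; have id u : shift (t + (m * t - t)) u = u.
  by apply: shift_id; rewrite subnKC ?leq_pmull // modnMr mod0n.
by rewrite -(id p) -(id q) -!shiftD pq.
Qed.

(** The action is free on moving points, so one moved point determines the shift. *)
Lemma shift_inj_time t u p :
  p < c * m -> t < m -> u < m -> shift t p = shift u p -> t = u.
Proof.
move=> pc tm um /(congr1 (modn^~ m)); rewrite !shift_mod // => /eqP.
by rewrite eqn_modDl !modn_small // => /eqP.
Qed.

(** A complete invariant of the orbit of an arc with moving tail: [normal_shift] gives invariance
    and [normalP] completeness. *)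
Definition normal (pq : nat * nat) : nat * nat :=
  (pq.1 %/ m * m, shift (m - pq.1 %% m) pq.2).

Lemma normal_shift t p q : p < c * m -> normal (shift t p, shift t q) = normal (p, q).
Proof.
move=> pc; rewrite /normal /= shift_div // shiftD; congr (_, _).
apply: eq_shift; apply/eqP; rewrite shift_mod // -(eqn_modDr ((p + t) %% m)).
have pm := ltn_pmod p m_gt0; have ptm := ltn_pmod (p + t) m_gt0.
rewrite -addnA subnK ?(ltnW ptm) // modnDr modnDmr.
have -> : m - p %% m + (p + t) = m + (p %/ m * m + t).
  by rewrite {2}(divn_eq p m); lia.
by rewrite modnDl modnMDl.
Qed.

Lemma normalP p q x y :
    p < c * m -> x < c * m -> normal (p, q) = normal (x, y) ->
  exists2 t, t < m & shift t p = x /\ shift t q = y.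
Proof.
move=> pc xc [/eqP pxm pqxy].
have px : p %/ m = x %/ m by move: pxm; rewrite eqn_pmul2r // => /eqP.
have pm := ltn_pmod p m_gt0; have xm := ltn_pmod x m_gt0.
exists ((m - p %% m + x %% m) %% m); first exact: ltn_pmod.
rewrite !(eq_shift _ (modn_mod (m - p %% m + x %% m) m)); split.
  rewrite /shift pc px {1}(divn_eq p m) -addnA modnMDl addnA subnKC ?(ltnW pm) //.
  by rewrite modnDl modn_mod -divn_eq.
rewrite -shiftD pqxy shiftD subnK ?(ltnW xm) //.
by apply: shift_id; rewrite modnn mod0n.
Qed.

End Shift.

(** The first vertex [lo] is 1 for the listed graphs, whose carrier has an idle 0, and 0 for the
    triangle; one development lemma thus serves both. *)
Definition listed (v lo : nat) (G : graph 'I_v.+1) (s : seq (nat * nat)) : Prop :=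
  [/\ edges G = list_edges v s,
      all (fun p => (lo <= p.1 <= v) && (lo <= p.2 <= v)) s
    & forall x, x \in vertices G -> lo <= x].

Section BaseBlocks.

Variables (lo : nat) (s : seq (nat * nat)) (m c n : nat).

(** Both orientations are kept, so that an edge with one fixed end is still seen from its moving
    end. *)
Definition arcs (b : seq nat) : seq (nat * nat) :=
  flatten [seq let x := nth 0 b (p.1 - lo) in let y := nth 0 b (p.2 - lo) in
               [:: (x, y); (y, x)] | p <- s].

Definition code (pq : nat * nat) := bin_of_nat (pq.1 * n + pq.2).

Definition block_arcs (bs : seq (seq nat)) : seq (nat * (nat * nat)) :=
  [seq (i, pq) | i <- iota 0 (size bs),
     pq <- [seq pq <- arcs (nth [::] bs i) | pq.1 < c * m]].

(* Shifting an arc so that its tail becomes the first point of its interval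
   gives one representative of each orbit of arcs. The representatives are
   encoded as binary numbers to make their comparison efficient. *)
Definition normal_codes (bs : seq (seq nat)) :=
  [seq code (normal m c ipq.2) | ipq <- block_arcs bs].

(** Duplicate-free codes mean that each orbit of arcs is hit at most once, the last clause that it
    is hit at least once. For even [m] an edge of difference [m / 2] inside an interval gives two
    arcs with the same code and is rejected; in all uses [m] is odd or such pairs are not edges. *)
Definition base_blocks (v : nat) (E : rel nat) (bs : seq (seq nat)) : bool :=
  [&& 0 < m, c * m <= n,
      all (fun b => [&& size b == v.+1 - lo, uniq b & all (fun x => x < n) b]) bs,
      all (fun b => all (fun pq => E pq.1 pq.2) (arcs b)) bs
    & let r := normal_codes bs in uniq r &&
      all (fun o => all (fun q => (q != o * m) && E (o * m) q ==>
             (code (o * m, q) \in r)) (iota 0 n)) (iota 0 c)].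

End BaseBlocks.

Lemma code_inj n p q p' q' : q < n -> q' < n ->
  code n (p, q) = code n (p', q') -> (p, q) = (p', q').
Proof.
move=> qn qn' /(can_inj bin_of_natK) /= pq.
have n0 : 0 < n by lia.
have := congr1 (divn^~ n) pq; have := congr1 (modn^~ n) pq.
rewrite !modnMDl !modn_small // => ->.
by rewrite !divnMDl // !divn_small // !addn0 => ->.
Qed.

Lemma mem_arcs lo s b x y :
  ((x, y) \in arcs lo s b) = ((y, x) \in arcs lo s b).
Proof.
suff half u w : (u, w) \in arcs lo s b -> (w, u) \in arcs lo s b.
  by apply/idP/idP; apply: half.
move=> /flattenP[_ /mapP[p ps ->]] uw; apply/flattenP.
by eexists; [apply/mapP; exists p|]; move: uw; rewrite //= !inE !xpair_eqE;
   case/orP=> /andP[/eqP-> /eqP->]; rewrite !eqxx ?orbT.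
Qed.

Section Develop.

Variables (v lo : nat) (G : graph 'I_v.+1) (s : seq (nat * nat)).
Hypothesis sG : listed lo G s.
Variables (m c n : nat) (E : rel nat) (bs : seq (seq nat)).
Hypothesis E_sym : symmetric E.
Hypothesis E_shift : forall t p q, p < n.+1 -> q < n.+1 ->
  E (shift m c t p) (shift m c t q) = E p q.
Hypothesis E_fixed : forall p q, c * m <= p -> c * m <= q ->
  p < n.+1 -> q < n.+1 -> E p q = false.
Hypothesis bsP : base_blocks lo s m c n.+1 v E bs.

Let sh := shift m c.
Let lab (i x : nat) := nth 0 (nth [::] bs i) (x - lo).
Let blk (i : 'I_(size bs)) (t : 'I_m) : {ffun 'I_v.+1 -> 'I_n.+1} :=
  [ffun x : 'I_v.+1 => inord (sh t (lab i x))].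

Let m_gt0 : 0 < m. Proof. by case/and5P: bsP. Qed.
Let cn : c * m <= n.+1. Proof. by case/and5P: bsP. Qed.

Let bP i : i < size bs -> [/\ size (nth [::] bs i) = v.+1 - lo,
  uniq (nth [::] bs i) & forall x, x \in nth [::] bs i -> x < n.+1].
Proof.
move=> ib; case/and5P: bsP => _ _ /allP/(_ _ (mem_nth [::] ib)) + _ _.
by case/and3P=> /eqP ? ? /allP.
Qed.

Let lab_lt i x : i < size bs -> lo <= x <= v -> lab i x < n.+1.
Proof. by move=> /bP[sz _ bn] xv; apply/bn/mem_nth; rewrite sz; lia. Qed.

Let sh_lt t p : p < n.+1 -> sh t p < n.+1.
Proof. exact: shift_lt. Qed.

Let arc_lt i p q : i < size bs -> (p, q) \in arcs lo s (nth [::] bs i) ->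
  (p < n.+1) && (q < n.+1).
Proof.
move=> ib /flattenP[_ /mapP[e es ->]]; rewrite !inE !xpair_eqE.
have [_ /allP/(_ e es) /andP[e1 e2] _] := sG.
by case/orP=> /andP[/eqP-> /eqP->]; rewrite ?(@lab_lt i e.1) ?(@lab_lt i e.2).
Qed.

Let copy_blkP (i : 'I_(size bs)) (t : 'I_m) (x y : 'I_n.+1) :
  reflect (exists2 pq, pq \in arcs lo s (nth [::] bs i) &
             x = sh t pq.1 :> nat /\ y = sh t pq.2 :> nat)
          ([set x; y] \in copy G (blk i t)).
Proof.
have [GE sv _] := sG.
have blkE e : e \in s -> blk i t @: [set inord e.1; inord e.2] =
    [set inord (sh t (lab i e.1)); inord (sh t (lab i e.2))].
  move=> es; have /andP[/andP[_ e1] /andP[_ e2]] := allP sv e es.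
  by rewrite imsetU1 imset_set1 !ffunE !inordK.
have shK e k : e \in s -> (k = e.1 \/ k = e.2) ->
    (inord (sh t (lab i k)) : 'I_n.+1) = sh t (lab i k) :> nat.
  move=> es k12; rewrite inordK // sh_lt // lab_lt //.
  by have /andP[e1 e2] := allP sv e es; case: k12 => ->.
rewrite /copy GE; apply: (iffP imsetP) => [[_ /[1!inE] /mapP[e es ->]]|].
  rewrite blkE // => /eqP/set2_eqP xy.
  (* The unordered pair matches [e] in one of two orders; the test selects the orientation that
     fits. *)
  exists (if (x == inord (sh t (lab i e.1))) && (y == inord (sh t (lab i e.2)))
          then (lab i e.1, lab i e.2) else (lab i e.2, lab i e.1)).
    apply/flattenP; eexists; first by apply/mapP; exists e.
    by case: ifP => _; rewrite !inE eqxx ?orbT.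
  case: ifP => [/andP[/eqP-> /eqP->]|]; first by rewrite !(shK e); auto.
  by case: xy => -[-> ->]; rewrite ?eqxx // !(shK e); auto.
case=> pq /flattenP[_ /mapP[e es ->] pqe] [xp yq].
exists [set inord e.1; inord e.2].
  by rewrite inE; apply/mapP; exists e.
apply/eqP; rewrite blkE //; apply/set2_eqP.
move: pqe xp yq; rewrite !inE => /orP[] /eqP -> /= xp yq; [left|right];
  by split; apply: val_inj; rewrite /= ?xp ?yq (shK e); auto.
Qed.

Let block_arcsP i pq : i < size bs -> pq \in arcs lo s (nth [::] bs i) ->
  pq.1 < c * m -> (i, pq) \in block_arcs lo s m c bs.
Proof.
move=> ib pqa pm; apply/allpairsPdep; exists i, pq.
by rewrite mem_iota ib mem_filter pm.
Qed.

(** Since the action is free on moving points, an arc with moving tail is given by its orbit and a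
    shift; the check matches orbits with arcs of base blocks one to one. *)
Lemma develop : decomposable G (fun x y : 'I_n.+1 => E x y).
Proof.
have [GE sv Gv] := sG.
have [_ _ _ /allP EP /andP[cuniq /allP ccover]] := and5P bsP.
exists [set blk p.1 p.2 | p in [set: 'I_(size bs) * 'I_m]]; split.
- move=> _ /imsetP[[i t] _ ->] x y /Gv xlo /Gv ylo /(congr1 val) /=.
  have labn (z : 'I_v.+1) : lo <= z -> sh t (lab i z) < n.+1.
    by move=> zlo; apply: sh_lt; apply: lab_lt => //; rewrite zlo -ltnS ltn_ord.
  rewrite !ffunE !inordK ?labn // => /(shift_inj m_gt0) /eqP.
  have [sz bu _] := bP (ltn_ord i).
  have xv := ltn_ord x; have yv := ltn_ord y.
  rewrite /lab nth_uniq ?sz //; [|lia|lia] => /eqP xy; apply: val_inj => /=; lia.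
- move=> _ /imsetP[[i t] _ ->] x y /copy_blkP[[p q] pq [-> ->]].
  have /andP[pn qn] := arc_lt (ltn_ord i) pq.
  by rewrite E_shift //; apply: (allP (EP _ (mem_nth [::] (ltn_ord i))) _ pq).
(* By [E_fixed] some end of the edge moves, and by symmetry it may be taken first. *)
- suff half x y : x < c * m -> x != y -> E x y -> x < n.+1 -> y < n.+1 ->
      exists i : 'I_(size bs), exists t : 'I_m,
      exists2 pq, pq \in arcs lo s (nth [::] bs i) &
        x = sh t pq.1 /\ y = sh t pq.2.
    move=> x y xy Exy; have xn := ltn_ord x; have yn := ltn_ord y.
    have [xc|xc] := ltnP x (c * m).
      have [i [t ixy]] := half x y xc xy Exy xn yn.
      exists (blk i t); last exact/copy_blkP.
      by apply/imsetP; exists (i, t).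
    have [yc|yc] := ltnP y (c * m); last by rewrite E_fixed in Exy.
    have yx : y != x :> nat by rewrite eq_sym.
    have Eyx : E y x by rewrite E_sym.
    have [i [t [[p q] pq [yp xq]]]] := half y x yc yx Eyx yn xn.
    exists (blk i t); first by apply/imsetP; exists (i, t).
    by apply/copy_blkP; exists (q, p); rewrite 1?mem_arcs.
  move=> xc xy Exy xn yn.
  have xo : x %/ m < c by rewrite ltn_divLR.
  have cx : x %/ m \in iota 0 c by rewrite mem_iota.
  (* This shift brings [x] to the first point of its interval, where the coverage check applies. *)
  have shx : sh (m - x %% m) x = x %/ m * m.
    rewrite /sh /shift xc {2}(divn_eq x m) -addnA modnMDl subnKC.
      by rewrite modnn addn0.
    exact/ltnW/ltn_pmod.
  have yi : sh (m - x %% m) y \in iota 0 n.+1 by rewrite mem_iota sh_lt.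
  have := allP (ccover _ cx) _ yi.
  rewrite -{1 2}shx (inj_eq (@shift_inj m c m_gt0 _)) eq_sym xy E_shift // Exy /=.
  case/mapP=> [[i pq]] /allpairsPdep[j [pq' [ji pqj [ij pqpq']]]].
  subst j pq'; rewrite mem_iota in ji.
  move: pqj; rewrite mem_filter => /andP[pc pqa]; case: pq pc pqa => p q /= pc pqa.
  have /andP[pn qn] := arc_lt ji pqa.
  move/code_inj; rewrite !sh_lt // => /(_ isT isT) xypq.
  have [|t tm [tp tq]] := @normalP m c m_gt0 p q x y pc xc.
    exact: (esym xypq).
  by exists (Ordinal ji), (Ordinal tm), (p, q).
- move=> _ _ /imsetP[[i t] _ ->] /imsetP[[j u] _ ->] x y.
  have [ib jb] := (ltn_ord i, ltn_ord j).
  suff half (p q p' q' : nat) : (p, q) \in arcs lo s (nth [::] bs i) ->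
      (p', q') \in arcs lo s (nth [::] bs j) -> p < c * m ->
      sh t p = sh u p' -> sh t q = sh u q' -> (i, t) = (j, u).
    move=> /copy_blkP[[p q] pqi [/= xp yq]] /copy_blkP[[p' q'] pqj [/= xp' yq']].
    have [pc|pc] := ltnP p (c * m).
      by have [-> ->] := half p q p' q' pqi pqj pc (etrans (esym xp) xp')
         (etrans (esym yq) yq').
    have [qc|qc] := ltnP q (c * m).
      rewrite mem_arcs in pqi; rewrite mem_arcs in pqj.
      by have [-> ->] := half q p q' p' pqi pqj qc (etrans (esym yq) yq')
         (etrans (esym xp) xp').
    have /andP[pn qn] := arc_lt ib pqi.
    by have := allP (EP _ (mem_nth [::] ib)) _ pqi; rewrite /= E_fixed.
  move=> pqi pqj pc pp qq.
  have pc' : p' < c * m.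
    by rewrite -(shift_moving c m_gt0 u) -[shift _ _ _ _]pp shift_moving.
  have /andP[_ qn] := arc_lt ib pqi; have /andP[_ qn'] := arc_lt jb pqj.
  have pqij := @block_arcsP i (p, q) ib pqi pc.
  have pqij' := @block_arcsP j (p', q') jb pqj pc'.
  (* Arcs with a common shift have the same normal form, so distinctness of the codes identifies the
     block and the arc. *)
  have [ij pp' _] : (val i, (p, q)) = (val j, (p', q')).
    apply: (uniq_map_inj cuniq pqij pqij').
    congr code; rewrite /= -(normal_shift m_gt0 t q pc) -(normal_shift m_gt0 u q' pc').
    by rewrite -/sh pp qq.
  rewrite -pp' in pp.
  have tu := shift_inj_time pc (ltn_ord t) (ltn_ord u) pp.
  by congr (_, _); apply: val_inj.
Qed.

End Develop.

(** * Inflation and filling *)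

Lemma listed_graph_of_list v s (ok : all (valid_edge v) s) :
  listed 1 (graph_of_list ok) s.
Proof.
split=> // [|x]; last by rewrite inE.
by apply: sub_all ok => p /and3P[/andP[-> ->] /andP[-> ->]].
Qed.

Lemma listed_complete3 : listed 0 (complete 3) [:: (0, 1); (0, 2); (1, 2)].
Proof.
split=> //; apply/setP => e; rewrite !inE /=; apply/cards2P/idP; last first.
  by case/or3P=> /eqP->; do 2 eexists; (split; [|reflexivity]);
     rewrite -val_eqE /= !inordK.
case=> x [y [xy ->]].
have -> : x = inord x by rewrite inord_val.
have -> : y = inord y by rewrite inord_val.
case: x y xy => [[|[|[|//]]] ?] [[|[|[|//]]] ?] // _; rewrite /= ?eqxx ?orbT //;
  by rewrite ?(setUC [set inord 2]) ?(setUC [set inord 1] [set inord 0])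
             ?eqxx ?orbT.
Qed.

Lemma copy_completeP h (V : finType) (f : {ffun 'I_h -> V}) x y :
  injective f ->
  reflect (x != y /\ (x \in codom f) && (y \in codom f))
          ([set x; y] \in copy (complete h) f).
Proof.
move=> fI; apply: (iffP imsetP) => [[e eE xye]|[xy /andP[/codomP[a xa] /codomP[b yb]]]].
  have e2 : #|[set x; y]| = 2.
    by rewrite xye card_imset //; apply/eqP; rewrite inE in eE.
  split; first by move: e2; rewrite cards2; case: eqP.
  have : x \in f @: e by rewrite -xye !inE eqxx.
  case/imsetP=> a _ ->; have : y \in f @: e by rewrite -xye !inE eqxx orbT.
  by case/imsetP=> b _ ->; rewrite !codom_f.
exists [set a; b]; last by rewrite imsetU1 imset_set1 xa yb.
rewrite inE cards2; suff -> : a != b by [].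
by apply: contraNneq xy => ab; rewrite xa yb ab.
Qed.

Lemma card_set_inr (X Y : finType) :
  #|[set u : X + Y | if u is inr _ then true else false]| = #|Y|.
Proof.
have <- : inr @: [set: Y] = [set u : X + Y | if u is inr _ then true else false].
  apply/setP => -[x|y]; rewrite inE; first by apply/imsetP=> -[].
  by apply/imsetP; exists y.
by rewrite card_imset ?cardsT // => x y [].
Qed.

Section Constructions.

Variables (T : finType) (G : graph T).

Definition multipartite (g w : nat) : Prop :=
  decomposable G (fun p q : 'I_g * 'I_w => p.1 != q.1).

(** Wilson's fundamental construction: each block is a [K_h] and inflates to a complete [h]-partite
    graph. An edge of the inflated graph lies over an edge of [E], hence over exactly one block. *)
Lemma decomposable_blowup h w (V : finType) (E : rel V) :
    irreflexive E -> decomposable (complete h) E -> multipartite h w ->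
  decomposable G (fun p q : V * 'I_w => E p.1 q.1).
Proof.
move=> Eirr [B [BI BE BC BU]] hw.
have fI (f : {ffun 'I_h -> V}) : f \in B -> injective f.
  by move=> /BI fI x y; apply: fI; rewrite inE.
pose F (f : {f : {ffun 'I_h -> V} | f \in B}) (p q : V * 'I_w) :=
  (p.1 != q.1) && ([set p.1; q.1] \in copy (complete h) (val f)).
apply: (@decomposable_bigcup _ _ _ _ _ F).
- case=> f fB; have fi := fI f fB.
  pose k (p : 'I_h * 'I_w) := (f p.1, p.2).
  apply: (@decomposable_image _ _ _ _ k _ _ _ _ _ hw).
  + by move=> [a i] [b j] [/fi-> ->].
  + move=> [a i] [b j] _; rewrite /F /= (inj_eq fi).
    case: eqVneq => //= ab; apply/(copy_completeP _ _ fi).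
    by rewrite !codom_f (inj_eq fi).
  + move=> [x i] [y j] _ /andP[/= _ /(copy_completeP _ _ fi)[_]].
    case/andP=> /codomP[a ->] /codomP[b ->].
    by apply/andP; split; apply/codomP; [exists (a, i) | exists (b, j)].
- move=> [x i] [y j] _ /=; apply/idP/existsP => [Exy|[[f fB] /andP[_ /= xyf]]].
    have xy : x != y by apply: contraTneq Exy => ->; rewrite Eirr.
    have [f fB xyf] := BC x y xy Exy.
    by exists (exist _ f fB); rewrite /F /= xy.
  exact: BE f fB x y xyf.
- move=> [x i] [y j] [f fB] [g gB] _ /andP[/= _ xyf] /andP[/= _ xyg].
  exact/val_inj/(BU f g fB gB x y xyf xyg).
Qed.

(** All groups share the [q] new points, whose mutual edges must stay uncovered; hence each group is
    completed by a graph with a hole. *)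
Lemma fill_groups (X C : finType) (g : X -> C) w q :
    decomposable G (fun x y : X * 'I_w => g x.1 != g y.1) ->
    (forall a, has_holed G (w * #|[set x | g x == a]| + q) q) ->
  has_holed G (w * #|X| + q) q.
Proof.
move=> gE gfill; pose V := (X * 'I_w + 'I_q)%type.
pose A : {set V} := [set u | if u is inr _ then true else false].
have cardA : #|A| = q by rewrite card_set_inr card_ord.
exists V, A; split=> //; first by rewrite card_sum card_prod !card_ord mulnC.
(* [None] stands for the edges between groups, [Some a] for those within group [a] or from it to the
   new points. *)
pose F (a : option C) : rel V := fun u v => match a, u, v with
  | None, inl p, inl p' => g p.1 != g p'.1
  | Some a, inl p, inl p' => (g p.1 == a) && (g p'.1 == a)
  | Some a, inl p, inr _ => g p.1 == a
  | Some a, inr _, inl p => g p.1 == a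
  | _, _, _ => false end.
apply: (@decomposable_bigcup _ _ _ _ _ F).
- case=> [a|]; last first.
    apply: (@decomposable_image _ _ _ _ inl _ _ _ _ _ gE) => [x y []|//|].
      by [].
    by case=> [p|i] [p'|i'] _ //= _; rewrite !codom_f.
  pose Va := ({x | x \in [set x | g x == a]} * 'I_w + 'I_q)%type.
  pose Aa : {set Va} := [set u | if u is inr _ then true else false].
  have cardAa : #|Aa| = q by rewrite card_set_inr card_ord.
  have : holed G Aa.
    apply: has_holedP; rewrite cardAa card_sum card_prod !card_ord card_sig mulnC.
    exact: gfill.
  pose k (u : Va) : V :=
    match u with inl p => inl (val p.1, p.2) | inr i => inr i end.
  apply: (@decomposable_image _ _ _ _ k).
  + by move=> [[x i]|i] [[y j]|j] //= [] => [/val_inj-> ->|->].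
  + have ga (x : {x | x \in [set x | g x == a]}) : g (val x) == a.
      by have := valP x; rewrite inE.
    by move=> [[x i]|i] [[y j]|j] _; rewrite /= !inE ?ga.
  + have ink x i : g x == a -> inl (x, i) \in codom k.
      move=> xa; apply/codomP.
      have xa' : x \in [set x | g x == a] by rewrite inE.
      by exists (inl (exist _ x xa', i)).
    have inr_k i : inr i \in codom k by apply/codomP; exists (inr i).
    by move=> [[x i]|i] [[y j]|j] _ //=; rewrite ?inr_k ?andbT //;
       [case/andP=> xa ya; rewrite !ink | apply: ink | apply: ink].
- move=> [[x i]|i] [[y j]|j] _ /=; rewrite !inE /=; apply/esym.
  + apply/existsP; case: (eqVneq (g x) (g y)) => xy.
      by exists (Some (g x)); rewrite /= xy eqxx.
    by exists None.
  + by apply/existsP; exists (Some (g x)) => /=.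
  + by apply/existsP; exists (Some (g y)) => /=.
  + by apply/existsP=> -[[]].
- move=> [[x i]|i] [[y j]|j] [a|] [b|] _ //=.
  + by move=> /andP[/eqP<- _] /andP[/eqP<- _].
  + by move=> /andP[/eqP-> /eqP->]; rewrite eqxx.
  + by move=> /negP xy /andP[/eqP xa /eqP ya]; case: xy; rewrite xa ya.
  + by move=> /eqP<- /eqP<-.
  + by move=> /eqP<- /eqP<-.
Qed.

Lemma multipartite_holed g w : multipartite g.+1 w -> has_holed G w 0 ->
  has_holed G (w * g.+1) w.
Proof.
move=> gw w0; pose V := ('I_g.+1 * 'I_w)%type.
pose A : {set V} := [set p | p.1 == ord0].
exists V, A; split; first by rewrite card_prod !card_ord mulnC.
  have -> : A = setX [set ord0] setT by apply/setP => p; rewrite !inE andbT.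
  by rewrite cardsX cards1 cardsT card_ord mul1n.
(* Part [ord0] is left unfilled as the hole, so its index is free to denote the edges between
   parts. *)
pose F (a : 'I_g.+1) : rel V := fun p q =>
  if a == ord0 then p.1 != q.1 else (p.1 == a) && (q.1 == a).
apply: (@decomposable_bigcup _ _ _ _ _ F).
- rewrite /F => a; case: eqVneq => // a0.
  have : holed G (set0 : {set 'I_w}).
    by apply: has_holedP; rewrite cards0 card_ord.
  apply: (@decomposable_image _ _ _ _ (pair a)) => [i j []|i j _|] //=.
    by rewrite !inE eqxx.
  by move=> [b i] [d j] _ /= /andP[/eqP-> /eqP->]; rewrite !codom_f.
- move=> [a i] [b j] _; rewrite /= !inE /=; apply/idP/existsP.
    case: (eqVneq a b) => [<-|ab _]; last by exists ord0; rewrite /F eqxx.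
    by rewrite andbb => a0; exists a; rewrite /F (negbTE a0) /= eqxx.
  case=> d; rewrite /F; case: eqP => [_ /=|d0 /= /andP[/eqP-> _]].
    by apply: contra => /andP[/eqP-> /eqP->].
  by apply/negP => /andP[/eqP].
- move=> [a i] [b j] d e _; rewrite /F /=.
  case: (d =P ord0) => [->|_]; case: (e =P ord0) => [->|_] //.
  + by move=> /negP xy /andP[/eqP xa /eqP ya]; case: xy; rewrite xa ya.
  + by case/andP=> /eqP-> /eqP->; rewrite eqxx.
  + by move=> /andP[/eqP<- _] /andP[/eqP<- _].
Qed.

Lemma multipartite_mod g w n : g * w = n.+1 ->
  decomposable G (fun x y : 'I_n.+1 => x %% g != y %% g) -> multipartite g w.
Proof.
move=> gwn; have g0 : 0 < g by case: g gwn.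
have w0 : 0 < w by case: w gwn => //; rewrite muln0.
pose h (x : 'I_n.+1) : 'I_g * 'I_w :=
  (Ordinal (ltn_pmod x g0), insubd (Ordinal w0) (x %/ g)).
have hw (x : 'I_n.+1) : insubd (Ordinal w0) (x %/ g) = x %/ g :> nat.
  by rewrite val_insubd ltn_divLR // mulnC gwn ltn_ord.
have hI : injective h.
  move=> x y [xy /(congr1 val)]; rewrite /= !hw => xy'.
  by apply: val_inj; rewrite /= (divn_eq x g) (divn_eq y g) xy xy'.
apply: (decomposable_image hI) => // u u' _ _.
by rewrite !(inj_card_onto hI) // card_prod !card_ord gwn.
Qed.

End Constructions.

Section DevelopInstances.

Variables (v lo : nat) (G : graph 'I_v.+1) (s : seq (nat * nat)).
Hypothesis sG : listed lo G s.

(** Of the [n.+1] points at most one is fixed, so no edge joins two fixed points. *)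
Lemma develop_complete m c n bs : n <= c * m ->
  base_blocks lo s m c n.+1 v (fun p q => p != q) bs -> has_holed G n.+1 0.
Proof.
move=> ncm bsP; exists 'I_n.+1, set0; rewrite card_ord cards0; split=> //.
have m0 : 0 < m by case/and5P: bsP.
apply: eq_decomposable (develop sG _ _ _ bsP) => [x y|p q|t p q _ _|p q].
- by rewrite /= !inE.
- by rewrite eq_sym.
- by rewrite (inj_eq (@shift_inj m c m0 _)).
- by move=> pc qc pn qn; apply/negbTE; rewrite negbK; apply/eqP; lia.
Qed.

Lemma develop_multipartite g w n bs : g * w = n.+1 ->
  base_blocks lo s (g * w) 1 n.+1 v (fun p q => p %% g != q %% g) bs ->
  multipartite G g w.
Proof.
move=> gwn bsP; apply: (multipartite_mod gwn).
apply: (develop sG _ _ _ bsP) => [p q|t p q|p q]; first by rewrite eq_sym.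
- rewrite -gwn => pn qn; rewrite /shift !mul1n pn qn.
  by rewrite !divn_small // !mul0n !add0n !modn_dvdm ?dvdn_mulr // eqn_modDr.
- by rewrite mul1n gwn leqNgt => /negbTE ->.
Qed.

(** Under the trivial group every arc is its own orbit, and the check is a plain enumeration. *)
Lemma develop_trivial n (E : rel nat) bs : symmetric E ->
  base_blocks lo s 1 n.+1 n.+1 v E bs ->
  decomposable G (fun x y : 'I_n.+1 => E x y).
Proof.
move=> E_sym bsP; apply: (develop sG E_sym _ _ bsP) => [t p q pn qn|p q].
  by rewrite /shift muln1 pn qn !divn1 !muln1 !modn1 !addn0.
by rewrite muln1 leqNgt => /negbTE ->.
Qed.

End DevelopInstances.

(** * Group divisible designs with block size 3 *)

(** Uniqueness is obtained by computing the block through a pair with [blk], which avoids comparing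
    two blocks. *)
Lemma triangles (V I : finType) (P : pred I) (t : I -> 3.-tuple V)
    (E : rel V) (blk : V -> V -> I) :
    (forall i, P i -> uniq (t i)) ->
    (forall i x y, P i -> x != y -> x \in t i -> y \in t i ->
       E x y /\ blk x y = i) ->
    (forall x y, x != y -> E x y ->
       [/\ P (blk x y), x \in t (blk x y) & y \in t (blk x y)]) ->
  decomposable (complete 3) E.
Proof.
move=> tU tE tC.
pose f i : {ffun 'I_3 -> V} := [ffun a => tnth (t i) a].
have fI i : P i -> injective (f i).
  by move=> Pi a b; rewrite !ffunE => /tuple_uniqP; apply; apply: tU.
have fC i x : (x \in codom (f i)) = (x \in t i).
  apply/codomP/tnthP => -[a ->]; exists a; by rewrite ffunE.
exists [set f i | i in P]; split.
- by move=> _ /imsetP[i Pi ->] x y _ _; apply: fI.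
- move=> _ /imsetP[i Pi ->] x y /(copy_completeP _ _ (fI i Pi))[xy].
  by rewrite !fC => /andP[xi yi]; case: (tE i x y).
- move=> x y xy Exy; have [Pxy xt yt] := tC x y xy Exy.
  exists (f (blk x y)); first exact: imset_f.
  by apply/copy_completeP; [apply: fI | rewrite !fC xt yt].
- move=> _ _ /imsetP[i Pi ->] /imsetP[j Pj ->] x y.
  move=> /(copy_completeP _ _ (fI i Pi))[xy]; rewrite !fC => /andP[xi yi].
  move=> /(copy_completeP _ _ (fI j Pj))[_]; rewrite !fC => /andP[xj yj].
  by have [_ <-] := tE i x y Pi xy xi yi; have [_ <-] := tE j x y Pj xy xj yj.
Qed.

Definition nx (i : 'I_3) : 'I_3 := ordS i.
Definition pr (i : 'I_3) : 'I_3 := ord_pred i.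

Lemma nxK : cancel nx pr. Proof. exact: ordSK. Qed.
Lemma prK : cancel pr nx. Proof. exact: ord_predK. Qed.

Lemma nx_neq i : (nx i == i) = false.
Proof. by case: i => -[|[|[|]]]. Qed.

Lemma neq_nx i : (i == nx i) = false.
Proof. by rewrite eq_sym nx_neq. Qed.

Lemma nx2_neq i : (i == nx (nx i)) = false.
Proof. by case: i => -[|[|[|]]]. Qed.

Lemma nxP i j : [\/ i = j, j = nx i | i = nx j].
Proof.
case: i j => -[|[|[|//]]] ? [[|[|[|//]]] ?];
 by [constructor 1; apply: val_inj | constructor 2; apply: val_inj
    | constructor 3; apply: val_inj].
Qed.

(** * Common frame of the Bose, Skolem and twisted constructions *)

Section BoseSkolem.

(** Three layers of [b] points in cyclic order and [r] points at infinity. Distinct [x], [y] of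
    layer [i] are completed by [op i x y] in the next layer. This misses the edges from [x] to its
    square: for [x] in [D] such an edge is completed by the point at infinity [c i x], otherwise it
    is left to a group. [c_alt] keeps the two edges at a point from going to the same point at
    infinity. *)
Variables (b r : nat) (op : 'I_3 -> 'I_b -> 'I_b -> 'I_b).
Variables (D : pred 'I_b) (c : 'I_3 -> 'I_b -> option 'I_r) (root : 'I_3 -> 'I_b -> 'I_b).
Hypothesis opC : forall i, commutative (op i).
Hypothesis opI : forall i x, injective (op i x).
Hypothesis c_some : forall i x, D x -> c i x.
Hypothesis rootK : forall i x, D x -> root i (op i x x) = x.
Hypothesis c_alt : forall i x, D x -> D (op i x x) -> c (nx i) (op i x x) != c i x.

Let V := ('I_b * 'I_3 + 'I_r)%type.

(** A point reaches infinity through the edge to its square, or as the square of its root in the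
    previous layer. *)
Let meets (x : 'I_b) (i : 'I_3) (k : 'I_r) : bool :=
  (D x && (c i x == Some k)) ||
  let y := root (pr i) x in [&& D y, op (pr i) y y == x & c (pr i) y == Some k].

Definition bose_rel : rel V := fun u v => match u, v with
  | inl (x, i), inl (y, j) => if i == j then x != y else
      if j == nx i then (y != op i x x) || D x else (x != op j y y) || D y
  | inl (x, i), inr k | inr k, inl (x, i) => meets x i k
  | inr _, inr _ => false
  end.

Let I := ('I_3 * ('I_b * 'I_b) + 'I_3 * 'I_b)%type.

Let P (a : I) : bool :=
  match a with inl (_, (x, y)) => x < y | inr (_, x) => D x end.

(** For [x] in [D] the value [c i x] is never [None]; the fallback point is junk. *)
Let t (a : I) : 3.-tuple V := match a with
  | inl (i, (x, y)) => [tuple inl (x, i); inl (y, i); inl (op i x y, nx i)]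
  | inr (i, x) => [tuple (if c i x is Some k then inr k else inl (x, i)); inl (x, i);
                         inl (op i x x, nx i)]
  end.

Let line (i : 'I_3) (x y : 'I_b) : I := inl (i, if x < y then (x, y) else (y, x)).

(** Solves [op i x y = z] for [y]; the solution is [x] itself exactly when [z] is its square. *)
Let cross (i : 'I_3) (x z : 'I_b) : I :=
  if z == op i x x then inr (i, x) else line i x (invF (@opI i x) z).

Let blk_inf (x : 'I_b) (i : 'I_3) (k : 'I_r) : I :=
  if D x && (c i x == Some k) then inr (i, x) else inr (pr i, root (pr i) x).

(* Junk value of blk on pairs of points at infinity. *)
Variable i0 : I.

Let blk (u v : V) : I := match u, v with
  | inl (x, i), inl (y, j) => if i == j then line i x y else
      if j == nx i then cross i x y else cross j y x
  | inl (x, i), inr k | inr k, inl (x, i) => blk_inf x i k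
  | inr _, inr _ => i0
  end.

Let lineC i x y : x != y -> line i x y = line i y x.
Proof. by move=> xy; rewrite /line; case: ltngtP => // /val_inj/eqP; rewrite (negbTE xy). Qed.

Let bose_rel_sym : symmetric bose_rel.
Proof.
move=> [[x i]|k] [[y j]|l] //=.
case: (nxP i j) => [->|->|->]; first by rewrite !eqxx eq_sym.
all: by rewrite !(nx_neq, neq_nx, nx2_neq, eqxx).
Qed.

Let blk_sym u v : u != v -> blk u v = blk v u.
Proof.
case: u v => [[x i]|k] [[y j]|l] //= uv.
case: (nxP i j) => [ij|ij|ij].
- by rewrite ij !eqxx lineC //; apply: contraNneq uv => ->; rewrite ij.
all: by rewrite ij !(nx_neq, neq_nx, nx2_neq, eqxx).
Qed.

Let cross_op i x y : x != y -> cross i x (op i x y) = line i x y.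
Proof.
move=> xy; rewrite /cross ifF; first by rewrite invF_f.
by apply: contraNF xy => /eqP/opI->.
Qed.

Lemma bose_skolem : decomposable (complete 3) bose_rel.
Proof.
apply: (@triangles V I P t bose_rel blk).
- case=> [[i [x y]]|[i x]] /= => [xy|/(@c_some i)]; rewrite !inE ?andbT; last first.
    case: (c i x) => // k _.
    by apply/eqP => -[_ /eqP]; rewrite neq_nx.
  rewrite !negb_or -andbA; apply/and3P; split; apply/eqP.
  + by case=> xy'; rewrite xy' ltnn in xy.
  + by case=> _ /eqP; rewrite neq_nx.
  + by case=> _ /eqP; rewrite neq_nx.
(* [bose_rel] and [blk] are symmetric, so three of the six ordered pairs of positions suffice. *)
- pose pairs a : seq (V * V) :=
    [:: (tnth (t a) ord0, tnth (t a) (inord 1));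
        (tnth (t a) ord0, tnth (t a) (inord 2));
        (tnth (t a) (inord 1), tnth (t a) (inord 2))].
  suff half a u v : P a -> (u, v) \in pairs a -> bose_rel u v /\ blk u v = a.
    move=> a u v Pa uv /tnthP[p up] /tnthP[q vq].
    suff : (u, v) \in pairs a \/ (v, u) \in pairs a.
      case=> /(half a _ _ Pa) //; rewrite bose_rel_sym (blk_sym (u := v)) //.
      by rewrite eq_sym.
    rewrite /pairs.
    move: up vq uv; rewrite -(inord_val p) -(inord_val q).
    have -> : ord0 = inord 0 :> 'I_3 by apply: val_inj; rewrite /= inordK.
    case: p q => -[|[|[|//]]] ? [[|[|[|//]]] ?] /= -> ->; rewrite ?eqxx // => _;
      rewrite !inE !eqxx ?orbT; auto.
  have t1 : inord 1 = Ordinal (isT : 1 < 3) by apply: val_inj; rewrite /= inordK.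
  have t2 : inord 2 = Ordinal (isT : 2 < 3) by apply: val_inj; rewrite /= inordK.
  rewrite /pairs t1 t2; case: a => [[i [x y]]|[i x]] /= Pa; rewrite !(tnth_nth u) /= !inE.
    have xy : x != y by apply: contraTneq Pa => ->; rewrite ltnn.
    have yx : y != x by rewrite eq_sym.
    case/or3P=> /eqP[-> ->] /=; rewrite ?eqxx ?neq_nx ?xy.
    + by rewrite /line Pa.
    + rewrite cross_op // /line Pa; split=> //.
      by rewrite (inj_eq (@opI i x)) yx.
    + rewrite opC cross_op // lineC // /line Pa; split=> //.
      by rewrite (inj_eq (@opI i y)) xy.
  have := c_some i Pa; have := @c_alt i x Pa; case cx : (c i x) => [k|] // calt _.
  case/or3P=> /eqP[-> ->] /=; rewrite ?eqxx ?neq_nx.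
  + by rewrite /meets /blk_inf Pa cx eqxx.
  + rewrite /meets /blk_inf nxK rootK // Pa cx !eqxx orbT; split=> //.
    case: ifP => // /andP[Dop /eqP cc].
    by have := calt Dop; rewrite cc eqxx.
  + by rewrite /cross eqxx Pa orbT.
- suff half x i v : inl (x, i) != v -> bose_rel (inl (x, i)) v ->
      [/\ P (blk (inl (x, i)) v), inl (x, i) \in t (blk (inl (x, i)) v)
        & v \in t (blk (inl (x, i)) v)].
    move=> [[x i]|k] v uv Euv; first exact: half.
    case: v uv Euv => [[y j]|l] // uv Euv.
    have [||? ? ?] := half y j (inr k); first by [].
      by rewrite bose_rel_sym.
    by rewrite blk_sym.
  have crossP j y z : (z != op j y y) || D y ->
      [/\ P (cross j y z), inl (y, j) \in t (cross j y z)
        & inl (z, nx j) \in t (cross j y z)].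
    rewrite /cross; case: eqVneq => [-> /= Dy|zy _]; first by rewrite !inE !eqxx ?orbT.
    have := f_invF (@opI j y) z; set y' := invF _ _ => yy'.
    have y'y : y' != y by apply: contraNneq zy => e; rewrite -yy' e.
    rewrite /line; case: ltngtP => [lt|lt|/val_inj/esym/eqP] /=.
    + by rewrite !inE yy' !eqxx ?orbT.
    + by rewrite !inE opC yy' !eqxx ?orbT.
    + by rewrite (negbTE y'y).
  case: v => [[y j]|k] uv /=.
    case: (nxP i j) => [ij|ij|ij]; rewrite ij ?eqxx ?nx_neq ?neq_nx ?nx2_neq.
    + rewrite /line => xy; case: ltngtP => [lt|lt|/val_inj/eqP] /=.
      * by rewrite !inE !eqxx ?orbT.
      * by rewrite !inE !eqxx ?orbT.
      * by rewrite (negbTE xy).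
    + exact: crossP.
    + by move=> /crossP[].
  rewrite /meets /blk_inf; case: ifP => [/andP[Dx /eqP cx] _|_ /=].
    by rewrite /= cx !inE !eqxx ?orbT.
  by case/and3P=> Dy /eqP yx /eqP cy; rewrite /= cy !inE Dy yx prK !eqxx ?orbT.
Qed.

End BoseSkolem.

(** Smaller groups make induction on [t] possible; the parity clause keeps it within even [t]. *)
Definition has_gdd (t : nat) : Prop :=
  exists (X C : finType) (g : X -> C),
    [/\ #|X| = t, decomposable (complete 3) (fun x y => g x != g y),
        forall a, #|[set x | g x == a]| < t
      & ~~ odd t -> forall a, ~~ odd #|[set x | g x == a]|].

Lemma card_fiber_lt (X C : finType) (g : X -> C) x y a :
  g x != g y -> #|[set z | g z == a]| < #|X|.
Proof.
move=> xy; rewrite -cardsT; apply: proper_card; rewrite properT.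
apply: contraNneq xy => aT.
have ga z : g z = a by apply/eqP; have := in_setT z; rewrite -aT inE.
by rewrite !ga.
Qed.

Lemma has_gdd_odd (X C : finType) (g : X -> C) x y :
    odd #|X| -> g x != g y ->
    decomposable (complete 3) (fun x y => g x != g y) ->
  has_gdd #|X|.
Proof.
move=> oX xy gE; exists X, C, g; split=> // [a|]; last by rewrite oX.
exact: card_fiber_lt xy.
Qed.

(** * Odd [b]: orders 6k+3 and 6k+5 *)

Section OddOrder.

Variable k : nat.

Let b := k.*2.+1.

Lemma half_mod x : (x * k.+1).*2 = x %[mod b].
Proof.
have -> : (x * k.+1).*2 = x * b + x by rewrite /b; nia.
by rewrite modnMDl.
Qed.

(** The mean of [x] and [y], as [k.+1] is the inverse of 2 modulo [b]: an idempotent commutative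
    quasigroup. *)
Definition half_op (x y : 'I_b) : 'I_b :=
  Ordinal (ltn_pmod ((x + y) * k.+1) (ltn0Sn k.*2)).

Definition opp (x : 'I_b) : 'I_b := Ordinal (ltn_pmod (b - x) (ltn0Sn k.*2)).

Lemma half_opC : commutative half_op.
Proof. by move=> x y; apply: val_inj; rewrite /= addnC. Qed.

Lemma half_opI x : injective (half_op x).
Proof.
move=> y z /(congr1 val) /= yz; apply: val_inj; apply/eqP.
have : (x + y == x + z %[mod b]).
  rewrite -(half_mod (x + y)) -(half_mod (x + z)) -!muln2.
  by rewrite -(modnMml (_ * k.+1)) yz modnMml.
by rewrite eqn_modDl !modn_small.
Qed.

Lemma half_opxx x : half_op x x = x.
Proof.
apply: val_inj; rewrite /= addnn -doubleMl half_mod modn_small //.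
Qed.

Lemma oppK : involutive opp.
Proof.
move=> x; apply: val_inj; rewrite /=.
have := ltn_ord x; case: (val x) => [|y] yb.
  by rewrite subn0 modnn subn0 modnn.
by rewrite (@modn_small (b - y.+1)) ?subKn ?modn_small //; lia.
Qed.

Lemma opp_neq0 (x : 'I_b) : (opp x != ord0) = (x != ord0).
Proof.
have opp0 : opp ord0 = ord0 by apply: val_inj; rewrite /= subn0 modnn.
by rewrite -{1}opp0 (inj_eq (can_inj oppK)).
Qed.

Lemma opp_side (x : 'I_b) : x != ord0 -> (opp x <= k) = ~~ (x <= k).
Proof.
rewrite -val_eqE /= => x0; have xb := ltn_ord x; rewrite modn_small; lia.
Qed.

Let b_block : 'I_3 * ('I_b * 'I_b) + 'I_3 * 'I_b := inr (ord0, ord0).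

(** Bose's construction: by idempotence the missed edges form the triangles over each [x], which are
    the groups. *)
Lemma has_gdd_6k3 : 0 < k -> has_gdd (6 * k + 3).
Proof.
move=> k0; pose V := ('I_b * 'I_3 + 'I_0)%type.
pose g (u : V) : 'I_b := match u with inl p => p.1 | inr _ => ord0 end.
have -> : 6 * k + 3 = #|{: V}| by rewrite card_sum card_prod !card_ord /b; lia.
apply: (@has_gdd_odd _ _ g (inl (ord0, ord0)) (inl (ord_max, ord0))).
- by rewrite card_sum card_prod !card_ord /b addn0 oddM /= odd_double.
- by rewrite /= -val_eqE /= eq_sym -lt0n double_gt0.
apply: eq_decomposable (@bose_skolem b 0 (fun=> half_op) xpred0
  (fun _ _ => None) (fun _ => id) (fun=> half_opC) (fun=> half_opI)
  _ _ _ b_block) => //.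
case=> [[x i]|[] //] [[y j]|[] //] _ /=; rewrite !half_opxx !orbF.
by case: (nxP i j) => [->|->|->]; rewrite ?eqxx ?nx_neq ?neq_nx ?nx2_neq // eq_sym.
Qed.

(* The squares of the third layer are negated, so that the uncovered edges
   outside the fibre of 0 form hexagons, whose edges are assigned alternately
   to the two points at infinity. *)
Definition twisted_op (i : 'I_3) (x y : 'I_b) : 'I_b :=
  if i == ord_max then opp (half_op x y) else half_op x y.

Definition twist (i : 'I_3) (x : 'I_b) : 'I_b := if i == ord_max then opp x else x.

(** The layer term flips the value on the steps 0 to 1 and 1 to 2, negation of [x] flips it on the
    step 2 to 0. *)
Definition side (i : 'I_3) (x : 'I_b) : option 'I_2 :=
  Some (if (x <= k) (+) (val i == 1) then ord0 else ord_max).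

Lemma twisted_opxx i x : twisted_op i x x = twist i x.
Proof. by rewrite /twisted_op half_opxx. Qed.

Lemma twistK i : involutive (twist i).
Proof. by move=> x; rewrite /twist; case: (i == ord_max) => //; rewrite oppK. Qed.

Lemma twist_neq0 i x : (twist i x != ord0) = (x != ord0).
Proof. by rewrite /twist; case: (i == ord_max) => //; rewrite opp_neq0. Qed.

Lemma side_alt i x : x != ord0 -> side (nx i) (twist i x) != side i x.
Proof.
rewrite /side /twist => x0; case: i => -[|[|[|//]]] ? /=; last rewrite opp_side //;
  by case: (x <= k).
Qed.

(** The fibre of 0 and the two points at infinity form one group of size 5; all other groups are
    single points. *)
Lemma has_gdd_6k5 : 0 < k -> has_gdd (6 * k + 5).
Proof.
move=> k0; pose V := ('I_b * 'I_3 + 'I_2)%type.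
pose g (u : V) : option ('I_b * 'I_3) :=
  match u with inl p => if p.1 == ord0 then None else Some p | inr _ => None end.
have max0 : (ord_max == ord0 :> 'I_b) = false.
  by rewrite -val_eqE /= -double0 eq_sym; case: k k0.
have -> : 6 * k + 5 = #|{: V}| by rewrite card_sum card_prod !card_ord /b; lia.
apply: (@has_gdd_odd _ _ g (inl (ord0, ord0)) (inl (ord_max, ord0))).
- by rewrite card_sum card_prod !card_ord /b oddD oddM /= odd_double.
- by rewrite /= max0.
have opC i : commutative (twisted_op i).
  by move=> x y; rewrite /twisted_op half_opC.
have opI i x : injective (twisted_op i x).
  move=> y z; rewrite /twisted_op; case: eqP => _; last exact: half_opI.
  by move/(can_inj oppK)/half_opI.
apply: eq_decomposable (@bose_skolem b 2 twisted_op (fun x => x != ord0)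
  side twist opC opI _ _ _ b_block) => [|//|i x _|i x x0 _]; first last.
- by rewrite twisted_opxx side_alt.
- by rewrite twisted_opxx twistK.
(* Off the fibre of 0 a point meets both points at infinity, one through its square and the other
   through its root. *)
have meetsT x i (l : 'I_2) : (x != ord0) && (side i x == Some l) ||
    [&& twist (pr i) x != ord0,
        twisted_op (pr i) (twist (pr i) x) (twist (pr i) x) == x
      & side (pr i) (twist (pr i) x) == Some l] = (x != ord0).
  rewrite twisted_opxx twistK twist_neq0 eqxx; case: eqVneq => //= x0.
  have := @side_alt (pr i) (twist (pr i) x); rewrite twist_neq0 twistK prK.
  move=> /(_ x0); rewrite /side; do 2 case: ifP => _ //.
  + by case: l => -[|[|//]].
  + by case: l => -[|[|//]].
case=> [[x i]|l] [[y j]|l'] uv /=; rewrite ?meetsT //.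
- rewrite !twisted_opxx; case: (nxP i j) => [ij|ij|ij].
  + have xy : x != y by apply: contraNneq uv => ->; rewrite ij.
    rewrite ij eqxx xy; apply/esym.
    apply: contraNneq xy.
    by case: (x =P ord0) => [->|_]; case: (y =P ord0) => [->|_] // [->].
  + rewrite ij neq_nx eqxx; case: (eqVneq x ord0) => [x0|x0]; rewrite ?orbT ?orbF /=.
      rewrite x0 (_ : twist i ord0 = ord0); first by case: (y == ord0).
      by apply/eqP; rewrite -[_ == _]negbK twist_neq0 eqxx.
    by case: (y == ord0); apply/esym/eqP => // -[_ /eqP]; rewrite neq_nx.
  + rewrite ij nx_neq nx2_neq; case: (eqVneq y ord0) => [y0|y0]; rewrite ?orbT ?orbF /=.
      rewrite y0 (_ : twist j ord0 = ord0); first by case: (x == ord0).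
      by apply/eqP; rewrite -[_ == _]negbK twist_neq0 eqxx.
    by case: (x == ord0); apply/esym/eqP => // -[_ /eqP]; rewrite nx_neq.
- by case: (x == ord0).
- by case: (y == ord0).
Qed.

End OddOrder.

(** * Even [b]: order 6k+1 *)

Section EvenOrder.

Variable k : nat.
Hypothesis k_gt0 : 0 < k.

Let b := k.*2.

Let b_gt0 : 0 < b. Proof. by rewrite double_gt0. Qed.

(** Lists even residues before odd ones, so that [2 * x] modulo [2 * k] goes to [x] modulo [k]:
    Skolem's half-idempotent quasigroup. *)
Definition half_perm (z : nat) : nat := (if odd z then k else 0) + z./2.

Lemma half_perm_lt z : z < b -> half_perm z < b.
Proof.
by rewrite /b /half_perm; have := odd_double_half z; case: odd => /=; lia.
Qed.

Lemma half_perm_inj y z : y < b -> z < b -> half_perm y = half_perm z -> y = z.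
Proof.
rewrite /b /half_perm; have := odd_double_half y; have := odd_double_half z.
by do 2 case: odd => /=; lia.
Qed.

Definition skolem_op (i : 'I_3) (x y : 'I_b) : 'I_b :=
  Ordinal (half_perm_lt (ltn_pmod (x + y) b_gt0)).

Lemma skolem_opC i : commutative (skolem_op i).
Proof. by move=> x y; apply: val_inj; rewrite /= addnC. Qed.

Lemma skolem_opI i x : injective (skolem_op i x).
Proof.
move=> y z /(congr1 val) /= yz; apply: val_inj; apply/eqP.
have /eqP : x + y = x + z %[mod b] by apply: half_perm_inj yz; apply: ltn_pmod.
by rewrite eqn_modDl !modn_small.
Qed.

Lemma skolem_opxx i (x : 'I_b) :
  skolem_op i x x = (if x < k then val x else x - k) :> nat.
Proof.
have xb := ltn_ord x; rewrite /= addnn.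
have -> : x.*2 %% b = (if x < k then val x else x - k).*2.
  case: ltnP => xk; first by rewrite modn_small // ltn_double.
  have -> : x.*2 = b + (x - k).*2 by rewrite /b -doubleD subnKC.
  by rewrite modnDl modn_small //; rewrite ltn_double ltn_subLR // addnn.
by rewrite /half_perm odd_double add0n doubleK.
Qed.

(** The squares are the points below [k], where [x + k] is in range. Elsewhere the default [x] is
    harmless, as its square is [x - k], not [x]. *)
Definition skolem_root (i : 'I_3) (x : 'I_b) : 'I_b := insubd x (x + k).

(** Skolem's construction: the triples over each [x < k] are kept as groups, all other points being
    single groups. *)
Lemma has_gdd_6k1 : has_gdd (6 * k + 1).
Proof.
pose V := ('I_b * 'I_3 + 'I_1)%type.
pose g (u : V) : V := match u with
  | inl p => if p.1 < k then inl (p.1, ord0) else u | inr _ => u end.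
have -> : 6 * k + 1 = #|{: V}| by rewrite card_sum card_prod !card_ord /b; lia.
apply: (@has_gdd_odd _ _ g (inl (Ordinal b_gt0, ord0)) (inr ord0)).
- by rewrite card_sum card_prod !card_ord /b oddD oddM /= odd_double.
- by rewrite /= k_gt0.
have rootK (i : 'I_3) (x : 'I_b) : k <= x -> skolem_root i (skolem_op i x x) = x.
  move=> kx; have xk : (x < k) = false by rewrite ltnNge kx.
  by apply: val_inj; rewrite val_insubd skolem_opxx xk subnK // ltn_ord.
apply: eq_decomposable (@bose_skolem b 1 skolem_op (fun x => k <= x)
  (fun _ _ => Some ord0) skolem_root skolem_opC skolem_opI _ rootK _
  (inr (ord0, Ordinal b_gt0))) => [|//|i x kx]; last first.
  have xk : (x < k) = false by rewrite ltnNge kx.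
  by rewrite skolem_opxx xk leqNgt ltn_subLR // addnn ltn_ord.
have crossE i (x y : 'I_b) : (y != skolem_op i x x) || (k <= x) =
    (g (inl (x, i)) != g (inl (y, nx i))).
  have inl_eq p q : (inl p == inl q :> V) = (p == q) by [].
  have -> : (y == skolem_op i x x) = (val y == if x < k then val x else x - k).
    by rewrite -(skolem_opxx i).
  rewrite /=; case: (ltnP x k) => xk; rewrite ?orbT ?orbF.
    case: (ltnP y k) => yk; rewrite inl_eq xpair_eqE.
      by rewrite eqxx andbT eq_sym.
    have xy : (x == y) = false by apply: contraTF xk => /eqP->; rewrite -leqNgt.
    have yx : (val y == val x) = false by rewrite eq_sym.
    by rewrite xy yx.
  case: (ltnP y k) => yk; rewrite inl_eq xpair_eqE ?neq_nx ?andbF //.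
  by have -> : (x == y) = false by apply: contraTF yk => /eqP<-; rewrite -leqNgt.
have meetsT (x : 'I_b) i (l : 'I_1) : (k <= x) && (Some ord0 == Some l) ||
    [&& k <= skolem_root (pr i) x,
        skolem_op (pr i) (skolem_root (pr i) x) (skolem_root (pr i) x) == x
      & Some ord0 == Some l].
  rewrite (ord1 l) eqxx !andbT; case: leqP => //= xk.
  have rx : skolem_root (pr i) x = x + k :> nat.
    rewrite val_insubd ifT //; apply: (@leq_trans (k + k)).
      by rewrite ltn_add2r.
    by rewrite addnn.
  have rxk : (skolem_root (pr i) x < k) = false by rewrite rx ltnNge leq_addl.
  rewrite rx leq_addl /=; apply/eqP/val_inj.
  by rewrite [LHS]skolem_opxx rxk rx addnK.
case=> [[x i]|l] [[y j]|l'] uv; rewrite /bose_rel ?meetsT //.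
- case: (nxP i j) => [ij|ij|ij]; rewrite ij ?eqxx ?nx_neq ?neq_nx ?nx2_neq.
  + have xy : x != y by apply: contraNneq uv => ->; rewrite ij.
    rewrite xy; apply/esym; apply: contraNneq xy => /=.
    by do 2 case: ifP => // _; case=> // ->.
  + exact: crossE.
  + by rewrite crossE eq_sym.
- by rewrite /=; case: ifP.
- by rewrite /=; case: ifP.
- by move: uv; rewrite !ord1 eqxx.
Qed.

End EvenOrder.

(** * Doubling and the small orders *)

Lemma triangles_222 : multipartite (complete 3) 3 2.
Proof.
apply: (@multipartite_mod _ _ 3 2 5) => //.
(* [K_{2,2,2}] is the octahedron; alternate faces use every edge once. *)
apply: (@develop_trivial 2 0 _ _ listed_complete3 5 (fun p q => p %% 3 != q %% 3)
  [:: [:: 0; 1; 2]; [:: 3; 1; 5]; [:: 0; 4; 5]; [:: 3; 4; 2]]) => //.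
by move=> p q; rewrite eq_sym.
Qed.

Lemma card_fiber_prod (X C W : finType) (g : X -> C) a :
  #|[set p : X * W | g p.1 == a]| = #|[set x | g x == a]| * #|W|.
Proof.
rewrite -cardsT -cardsX; apply: eq_card => p; by rewrite !inE andbT.
Qed.

Lemma has_gdd_double t : has_gdd t -> has_gdd t.*2.
Proof.
case=> X [C [g [Xt gE gt _]]].
exists (X * 'I_2)%type, C, (fun p => g p.1); split=> [||a|_ a].
- by rewrite card_prod card_ord Xt muln2.
- apply: decomposable_blowup gE triangles_222 => x.
  by rewrite eqxx.
- by rewrite card_fiber_prod card_ord muln2 ltn_double.
- by rewrite card_fiber_prod card_ord muln2 odd_double.
Qed.

Lemma has_gdd3 : has_gdd 3.
Proof.
rewrite -[3](card_ord 3).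
apply: (@has_gdd_odd _ _ id ord0 ord_max) => //; first by rewrite card_ord.
exact: (@develop_trivial 2 0 _ _ listed_complete3 2 (fun p q => p != q)
  [:: [:: 0; 1; 2]] (fun p q => congr1 negb (eq_sym p q))).
Qed.

Lemma has_gdd8 : has_gdd 8.
Proof.
exists ('I_4 * 'I_2)%type, 'I_4, (fun p => p.1).
have card4 a : #|[set p : 'I_4 * 'I_2 | p.1 == a]| = 2.
  by rewrite (card_fiber_prod _ id) card_ord (_ : [set x | id x == a] = [set a]) ?cards1 //;
     apply/setP => x; rewrite !inE.
split=> [||a|_ a]; rewrite ?card4 //; first by rewrite card_prod !card_ord.
(* The differences of 0, 1, 3 modulo 8 are all residues except 0 and 4. *)
apply: (@develop_multipartite 2 0 _ _ listed_complete3 4 2 7 [:: [:: 0; 1; 3]]) => //.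
Qed.

(** Three groups of size 2 and one of size 4. The edges among the first six points split into four
    perfect matchings, one for each of the points 6 to 9. *)
Definition group10 (x : nat) : nat := if x < 6 then x %% 3 else 3.

Lemma has_gdd10 : has_gdd 10.
Proof.
have g4 x : group10 x < 4.
  by rewrite /group10; case: ifP => // _; apply: (@leq_trans 3); rewrite ?ltn_pmod.
exists 'I_10, 'I_4, (fun x : 'I_10 => Ordinal (g4 x)).
have card10 a : #|[set x : 'I_10 | Ordinal (g4 x) == a]| = if a == ord_max then 4 else 2.
  rewrite cardsE -sum1_card big_mkcond /= !big_ord_recl big_ord0.
  by case: a => -[|[|[|[|//]]]] ?.
split=> [||a|_ a]; rewrite ?card10 ?card_ord //; try by case: ifP.
apply: (@develop_trivial 2 0 _ _ listed_complete3 9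
  (fun p q => group10 p != group10 q)
  [:: [:: 0; 1; 6]; [:: 2; 4; 6]; [:: 3; 5; 6]; [:: 0; 2; 7]; [:: 1; 3; 7];
      [:: 4; 5; 7]; [:: 0; 4; 8]; [:: 1; 5; 8]; [:: 2; 3; 8]; [:: 0; 5; 9];
      [:: 1; 2; 9]; [:: 3; 4; 9]]) => //.
by move=> p q; rewrite eq_sym.
Qed.

Theorem gdd_exists t : t \notin [:: 0; 1; 2; 4; 5] -> has_gdd t.
Proof.
elim/ltn_ind: t => t IH t0; have [ot|et] := boolP (odd t).
  have := divn_eq t 6; have := ltn_pmod t (isT : 0 < 6).
  move: (t %% 6) (t %/ 6) => r k r6 tk; rewrite mulnC in tk.
  move: t0 ot; rewrite {}tk oddD oddM /= {IH}.
  case: r r6 => [|[|[|[|[|[|//]]]]]] _ //; case: k => [|k] // _ _.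
  - exact: has_gdd_6k1.
  - exact: has_gdd3.
  - exact: has_gdd_6k3.
  - exact: has_gdd_6k5.
have t2 : t = t./2.*2 by rewrite -[LHS]odd_double_half (negbTE et).
(* Halves 0, 1, 2 belong to excluded [t]; only 8 and 10 remain. *)
have [m5|] := boolP (t./2 \in [:: 0; 1; 2; 4; 5]).
  move: t0; rewrite t2 {t2}; move: (t./2) m5 => m.
  by rewrite !inE => /or4P[/eqP->|/eqP->|/eqP->|/orP[]/eqP->] // _;
     [exact: has_gdd8 | exact: has_gdd10].
rewrite [in has_gdd _]t2 => m5; apply/has_gdd_double/IH => //.
by move: t0; rewrite !inE; lia.
Qed.

Section Spectrum.

Variables (T : finType) (G : graph T) (w q : nat).
Hypothesis tripartite : multipartite G 3 w.
Hypothesis hole2 : has_holed G (w * 2 + q) q.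
Hypothesis hole4 : has_holed G (w * 4 + q) q.

(** The flag [any] tells whether odd [t] are admissible. If not, the groups met in the induction are
    even and the cases 1 and 5 never arise. *)
Lemma holed_spectrum (any : bool) :
    (any -> has_holed G (w * 1 + q) q /\ has_holed G (w * 5 + q) q) ->
  forall t, any || ~~ odd t -> has_holed G (w * t + q) q.
Proof.
move=> hole15; elim/ltn_ind => t IH; have [|t0 anyt] := boolP (t \in [:: 0; 1; 2; 4; 5]).
  rewrite !inE => /or4P[/eqP->|/eqP->|/eqP->|/orP[]/eqP->] //=; rewrite ?orbF.
  - by rewrite muln0 => _; apply: has_holed_full.
  - by case/hole15.
  - by case/hole15.
have [X [C [g [Xt gE gt gev]]]] := gdd_exists t0; rewrite -Xt.
apply: (@fill_groups _ _ _ _ g) => [|a].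
  by apply: decomposable_blowup gE tripartite => x; rewrite eqxx.
by apply: IH => //; case/orP: anyt => [->//|/gev->]; rewrite orbT.
Qed.

End Spectrum.

(** * Spectra *)

Lemma has_holed_point (T : finType) (G : graph T) n :
  has_holed G n.+1 0 -> has_holed G n.+1 1.
Proof.
case=> V [A [Vn /eqP]]; rewrite cards_eq0 => /eqP-> VE.
have [x _|V0] := pickP V; last by move: Vn; rewrite eq_card0.
exists V, [set x]; rewrite cards1; split=> //.
apply: eq_decomposable VE => y z yz; rewrite /= !inE /=.
by apply/esym; apply: contra yz => /andP[/eqP-> /eqP->].
Qed.

Section Spectra.

Variables (v : nat) (s : seq (nat * nat)) (ok : all (valid_edge v) s) (e : nat).

Let G := graph_of_list ok.
Let sG : listed 1 G s := listed_graph_of_list ok.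

Hypothesis s_neq0 : s != [::].
Hypothesis e_gt1 : 1 < e.

Let edges_neq0 : edges G != set0.
Proof.
case: s s_neq0 ok @G @sG => // p s' _ ok' /=; apply/set0Pn.
by exists [set inord p.1; inord p.2]; rewrite inE inE eqxx.
Qed.

Let neq (p q : nat) := p != q.
Let neq_mod (g p q : nat) := p %% g != q %% g.

Let complete_of n b :
  base_blocks 1 s n.+1 1 n.+1 v neq b -> has_holed G n.+1 0.
Proof. by apply: (develop_complete sG); rewrite mul1n. Qed.

Let multipartite_of g w b : 0 < g -> 0 < w ->
  base_blocks 1 s (g * w) 1 (g * w) v (neq_mod g) b -> multipartite G g w.
Proof.
move=> g0 w0 gwb; have gw : (g * w).-1.+1 = g * w by rewrite prednK // muln_gt0 g0.
by apply: (@develop_multipartite _ _ _ _ sG _ _ _ b (esym gw)); rewrite gw.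
Qed.

Variable b3 : seq (seq nat).
Hypothesis b3P : base_blocks 1 s (3 * e) 1 (3 * e) v (neq_mod 3) b3.

Let e_gt0 : 0 < e := ltnW e_gt1.

(** From [2 * e = 3 * w], the orders [2 * e + w] and [4 * e + w] are [4 * w] and [7 * w]:
    multipartite graphs with all parts but the hole filled by [K_w]. *)
Lemma spectrum_w_mod_3w w m c bw b4w b7w : 3 * w = 2 * e -> w <= c * m + 1 ->
    base_blocks 1 s m c w v neq bw ->
    base_blocks 1 s (4 * w) 1 (4 * w) v (neq_mod 4) b4w ->
    base_blocks 1 s (7 * w) 1 (7 * w) v (neq_mod 7) b7w ->
  forall n, n = w %[mod 3 * w] -> has_design G n.
Proof.
move=> we wcm bwP b4wP b7wP n; have w0 : 0 < w by lia.
have Kw : has_holed G w 0.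
  case: w w0 we wcm bwP {b4wP b7wP} => // w _ _ wcm bwP.
  by apply: (develop_complete sG _ bwP); lia.
rewrite (@modn_small w) => [nw|]; last by lia.
rewrite (divn_eq n (3 * w)) nw we mulnC -mulnA mulnCA.
apply: has_design_of_holed => //; apply: (has_holed_fill _ Kw).
apply: (@holed_spectrum _ G e w _ _ _ false) => //; last by rewrite oddM.
- exact: multipartite_of b3P.
- have -> : e * 2 + w = w * 4 by lia.
  by apply: (@multipartite_holed _ G 3 w _ Kw); apply: (@multipartite_of 4 w b4w).
- have -> : e * 4 + w = w * 7 by lia.
  by apply: (@multipartite_holed _ G 6 w _ Kw); apply: (@multipartite_of 7 w b7w).
Qed.

Variables (b2 b4 : seq (seq nat)).
Hypothesis b2P : base_blocks 1 s (e * 2).+1 1 (e * 2).+1 v neq b2.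
Hypothesis b4P : base_blocks 1 s (e * 4).+1 1 (e * 4).+1 v neq b4.

Let point_spectrum (any : bool) :
    (any -> has_holed G e.+1 0 /\ multipartite G 5 e) ->
  forall t, any || ~~ odd t -> has_design G (e * t).+1.
Proof.
move=> hole15 t anyt; apply: has_design_of_holed => //; apply: has_holed1.
rewrite -(addn1 (e * t)); move: t anyt; apply: holed_spectrum.
- exact: multipartite_of b3P.
- by rewrite addn1; apply: has_holed_point; apply: complete_of b2P.
- by rewrite addn1; apply: has_holed_point; apply: complete_of b4P.
move=> /hole15[e1 e5].
have hole1 : has_holed G (e * 1 + 1) 1 by rewrite muln1 addn1; apply: has_holed_point.
(* For [t = 5] the parts of [K_{e,e,e,e,e}] are filled through one common extra point. *)
split=> //; rewrite -[5](card_ord 5); apply: (@fill_groups _ _ _ _ id) => // a.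
by rewrite (_ : [set x | id x == a] = [set a]) ?cards1 //; apply/setP => x; rewrite !inE.
Qed.

Lemma spectrum_1_mod_2e n : n = 1 %[mod 2 * e] -> has_design G n.
Proof.
rewrite (@modn_small 1) ?(leq_trans e_gt1 (leq_pmull e _)) // => n1.
rewrite (divn_eq n (2 * e)) n1 addn1 mulnC -mulnA mulnCA.
by apply: (@point_spectrum false) => //; rewrite oddM.
Qed.

Lemma spectrum_1_mod_e m c b1 b5 : e <= c * m ->
    base_blocks 1 s m c e.+1 v neq b1 ->
    base_blocks 1 s (5 * e) 1 (5 * e) v (neq_mod 5) b5 ->
  forall n, n = 1 %[mod e] -> has_design G n.
Proof.
move=> ecm b1P b5P n; rewrite (@modn_small 1) // => n1.
rewrite (divn_eq n e) n1 addn1 mulnC; apply: (@point_spectrum true) => // _.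
by split; [exact: (develop_complete sG ecm b1P) | exact: multipartite_of b5P].
Qed.

End Spectra.

(** * Base blocks *)

(* A base block lists the images of the vertices 1, 2, ... of the graph; Knxm
   is the complete n-partite graph with parts of size m, the parts being the
   residue classes mod n. For K_{4e+1} the second block is obtained from the
   first by multiplication by a square root of -1 mod 4e+1, if there is one. *)

Definition CS1_K3x39 : seq (seq nat) :=
  [:: [:: 36; 11; 72; 35; 113; 15; 55; 34; 39; 106; 17; 52; 114; 71; 103; 24;
          79; 57; 19; 10; 8; 69; 5; 96; 54; 44]].

Definition CS1_K79 : seq (seq nat) :=
  [:: [:: 22; 0; 34; 18; 61; 15; 57; 29; 67; 56; 3; 58; 49; 55; 21; 10; 78; 7;
          68; 14; 76; 46; 32; 52; 27; 8]].

(** The root is 28. Multiplication by it pairs off the 78 differences up to sign, so the 39 edges of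
    the first block need only meet each pair once. *)
Definition CS1_K157 : seq (seq nat) :=
  [:: [:: 138; 63; 65; 102; 19; 69; 85; 142; 134; 2; 104; 47; 71; 80; 3; 114;
          62; 5; 26; 127; 17; 25; 131; 70; 96; 135];
      [:: 96; 37; 93; 30; 61; 48; 25; 51; 141; 56; 86; 60; 104; 42; 84; 52; 9;
          140; 100; 102; 5; 72; 57; 76; 19; 12]].

Definition CS1_K40 : seq (seq nat) :=
  [:: [:: 20; 1; 9; 36; 2; 16; 27; 28; 31; 13; 7; 35; 29; 24; 22; 5; 10; 18;
          30; 39; 4; 6; 34; 8; 37; 12];
      [:: 6; 29; 16; 30; 25; 28; 4; 3; 27; 5; 24; 22; 36; 32; 37; 11; 38; 23;
          26; 13; 7; 15; 18; 21; 10; 31];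
      [:: 35; 14; 19; 6; 31; 36; 13; 10; 33; 1; 3; 22; 2; 30; 11; 4; 27; 7; 29;
          15; 21; 8; 17; 38; 20; 18];
      [:: 31; 25; 10; 39; 28; 35; 16; 32; 26; 12; 5; 36; 4; 14; 2; 0; 24; 7;
          30; 23; 22; 19; 15; 33; 1; 17]].

Definition CS1_K5x39 : seq (seq nat) :=
  [:: [:: 144; 167; 90; 111; 129; 26; 142; 16; 148; 57; 170; 87; 98; 10; 1; 51;
          191; 79; 3; 76; 193; 38; 19; 82; 84; 146];
      [:: 30; 169; 132; 73; 50; 63; 46; 123; 189; 116; 170; 84; 153; 121; 182;
          177; 25; 22; 173; 6; 78; 5; 149; 12; 55; 83]].

(** [K_40] has [780 = 20 * 39] edges: four base blocks under a group of order 5 on 8 intervals. *)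
Lemma CS1_spectrum n : n = 1 %[mod 39] -> has_design CS1 n.
Proof.
by apply: (@spectrum_1_mod_e _ _ _ 39 _ _ CS1_K3x39 _ CS1_K79 CS1_K157 _ _
  5 8 CS1_K40 CS1_K5x39); vm_compute.
Qed.

Definition CS2_K3x39 : seq (seq nat) :=
  [:: [:: 92; 45; 106; 74; 32; 111; 42; 52; 12; 61; 1; 84; 53; 96; 110; 47; 98;
          43; 104; 101; 3; 7; 102; 76; 103; 87]].

Definition CS2_K79 : seq (seq nat) :=
  [:: [:: 67; 22; 72; 60; 18; 71; 65; 11; 32; 21; 15; 45; 69; 24; 14; 58; 42;
          25; 39; 46; 52; 61; 28; 23; 74; 73]].

Definition CS2_K157 : seq (seq nat) :=
  [:: [:: 127; 46; 34; 117; 72; 134; 24; 35; 156; 7; 82; 0; 22; 62; 33; 136;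
          77; 36; 47; 50; 111; 91; 87; 3; 143; 142];
      [:: 102; 32; 10; 136; 132; 141; 44; 38; 129; 39; 98; 0; 145; 9; 139; 40;
          115; 66; 60; 144; 125; 36; 81; 84; 79; 51]].

Definition CS2_K40 : seq (seq nat) :=
  [:: [:: 31; 25; 32; 2; 39; 10; 0; 8; 22; 14; 4; 9; 34; 24; 33; 11; 7; 30; 1;
          27; 38; 26; 19; 21; 16; 17];
      [:: 36; 9; 7; 31; 17; 15; 1; 10; 18; 5; 33; 39; 37; 8; 25; 28; 16; 11;
          26; 23; 24; 6; 21; 35; 12; 4];
      [:: 11; 20; 30; 25; 35; 2; 33; 26; 10; 13; 12; 8; 17; 36; 24; 1; 16; 4;
          18; 29; 38; 7; 27; 3; 22; 19];
      [:: 7; 36; 1; 35; 20; 26; 3; 24; 34; 10; 27; 13; 14; 9; 16; 8; 18; 32;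
          21; 2; 38; 28; 30; 39; 23; 31]].

Definition CS2_K5x39 : seq (seq nat) :=
  [:: [:: 79; 28; 145; 186; 52; 63; 47; 93; 21; 67; 122; 44; 73; 180; 81; 62;
          45; 137; 13; 38; 88; 66; 105; 51; 101; 100];
      [:: 135; 88; 26; 94; 18; 14; 138; 62; 124; 82; 120; 39; 66; 193; 105; 83;
          64; 100; 77; 65; 17; 126; 32; 101; 169; 162]].

Lemma CS2_spectrum n : n = 1 %[mod 39] -> has_design CS2 n.
Proof.
by apply: (@spectrum_1_mod_e _ _ _ 39 _ _ CS2_K3x39 _ CS2_K79 CS2_K157 _ _
  5 8 CS2_K40 CS2_K5x39); vm_compute.
Qed.

Definition B21_K3x39 : seq (seq nat) :=
  [:: [:: 79; 52; 2; 95; 81; 48; 5; 37; 4; 86; 69; 27; 77; 25; 15; 13; 41; 0;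
          34; 60; 56; 71; 91; 28; 54; 23]].

Definition B21_K79 : seq (seq nat) :=
  [:: [:: 18; 25; 59; 46; 48; 22; 52; 23; 53; 30; 47; 58; 56; 76; 29; 19; 65;
          32; 12; 73; 24; 63; 5; 10; 3; 60]].

Definition B21_K157 : seq (seq nat) :=
  [:: [:: 16; 40; 81; 17; 120; 78; 33; 11; 83; 85; 138; 58; 156; 18; 50; 133;
          79; 130; 62; 115; 60; 52; 104; 137; 113; 14];
      [:: 134; 21; 70; 5; 63; 143; 139; 151; 126; 25; 96; 54; 129; 33; 144;
          113; 14; 29; 9; 80; 110; 43; 86; 68; 24; 78]].

Definition B21_K40 : seq (seq nat) :=
  [:: [:: 2; 8; 31; 25; 5; 9; 19; 14; 17; 22; 13; 0; 33; 16; 36; 37; 29; 32;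
          15; 24; 20; 1; 10; 28; 3; 30];
      [:: 24; 20; 31; 38; 25; 23; 39; 35; 16; 29; 3; 26; 36; 6; 1; 30; 21; 15;
          22; 14; 5; 27; 8; 37; 32; 7];
      [:: 26; 33; 25; 11; 1; 12; 31; 5; 18; 3; 17; 6; 9; 13; 35; 14; 27; 39; 0;
          2; 22; 21; 28; 8; 15; 24];
      [:: 16; 0; 13; 37; 15; 8; 23; 9; 12; 26; 29; 38; 10; 31; 32; 39; 34; 3;
          24; 11; 36; 14; 19; 17; 30; 2]].

Definition B21_K5x39 : seq (seq nat) :=
  [:: [:: 21; 130; 102; 180; 68; 103; 1; 107; 185; 120; 134; 147; 191; 31; 165;
          123; 158; 59; 137; 67; 153; 113; 6; 61; 29; 172];
      [:: 65; 40; 123; 56; 25; 37; 54; 119; 125; 193; 107; 113; 179; 64; 21;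
          175; 140; 177; 4; 14; 100; 176; 68; 153; 112; 71]].

Lemma B21_spectrum n : n = 1 %[mod 39] -> has_design B21 n.
Proof.
by apply: (@spectrum_1_mod_e _ _ _ 39 _ _ B21_K3x39 _ B21_K79 B21_K157 _ _
  5 8 B21_K40 B21_K5x39); vm_compute.
Qed.

Definition B22_K3x39 : seq (seq nat) :=
  [:: [:: 11; 114; 94; 40; 36; 109; 68; 53; 75; 91; 29; 26; 6; 48; 37; 22; 12;
          74; 4; 110; 107; 100; 72; 70; 95; 42]].

Definition B22_K79 : seq (seq nat) :=
  [:: [:: 31; 16; 23; 7; 61; 59; 8; 67; 12; 65; 47; 27; 2; 11; 33; 14; 71; 44;
          24; 48; 63; 39; 60; 62; 34; 76]].

Definition B22_K157 : seq (seq nat) :=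
  [:: [:: 129; 143; 133; 15; 146; 32; 119; 57; 101; 88; 151; 47; 29; 62; 59;
          137; 98; 46; 23; 115; 25; 6; 138; 121; 132; 79];
      [:: 1; 79; 113; 106; 6; 111; 35; 26; 2; 109; 146; 60; 27; 9; 82; 68; 75;
          32; 16; 80; 72; 11; 96; 91; 85; 14]].

Definition B22_K40 : seq (seq nat) :=
  [:: [:: 35; 6; 33; 5; 0; 22; 34; 39; 19; 29; 16; 12; 9; 30; 18; 8; 7; 32; 38;
          3; 15; 25; 4; 27; 14; 10];
      [:: 2; 27; 39; 25; 15; 11; 5; 0; 18; 4; 31; 10; 22; 16; 3; 24; 33; 29;
          19; 37; 28; 34; 9; 20; 23; 8];
      [:: 0; 33; 23; 3; 26; 32; 34; 11; 25; 38; 39; 29; 7; 20; 14; 35; 18; 12;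
          17; 37; 21; 2; 22; 13; 6; 9];
      [:: 19; 4; 30; 25; 5; 20; 31; 24; 36; 32; 11; 28; 14; 10; 3; 26; 17; 12;
          22; 23; 15; 38; 35; 37; 2; 7]].

Definition B22_K5x39 : seq (seq nat) :=
  [:: [:: 81; 177; 133; 47; 68; 123; 119; 145; 16; 157; 49; 40; 38; 164; 30;
          24; 141; 170; 2; 167; 91; 131; 172; 19; 110; 41];
      [:: 145; 85; 86; 136; 152; 143; 181; 58; 159; 174; 27; 162; 120; 131; 63;
          194; 191; 106; 127; 172; 41; 119; 117; 23; 169; 70]].

Lemma B22_spectrum n : n = 1 %[mod 39] -> has_design B22 n.
Proof.
by apply: (@spectrum_1_mod_e _ _ _ 39 _ _ B22_K3x39 _ B22_K79 B22_K157 _ _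
  5 8 B22_K40 B22_K5x39); vm_compute.
Qed.

Definition J7_K3x42 : seq (seq nat) :=
  [:: [:: 50; 9; 39; 108; 46; 68; 103; 34; 101; 26; 75; 21; 120; 48; 44; 33;
          10; 96; 71; 2; 25; 35; 91; 8; 36; 51; 65; 58]].

Definition J7_K85 : seq (seq nat) :=
  [:: [:: 28; 48; 70; 59; 33; 13; 8; 30; 29; 75; 7; 82; 27; 1; 5; 22; 34; 11;
          24; 6; 16; 49; 72; 12; 21; 84; 26; 45]].

Definition J7_K169 : seq (seq nat) :=
  [:: [:: 20; 166; 105; 123; 57; 18; 29; 10; 67; 12; 112; 28; 32; 120; 9; 73;
          0; 40; 41; 47; 104; 160; 70; 75; 23; 129; 114; 140];
      [:: 48; 128; 83; 160; 103; 77; 2; 24; 127; 164; 66; 101; 43; 119; 123;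
          40; 0; 96; 166; 79; 13; 46; 168; 11; 89; 73; 37; 167]].

Definition J7_K28 : seq (seq nat) :=
  [:: [:: 5; 16; 19; 23; 13; 18; 0; 25; 10; 9; 20; 15; 1; 22; 26; 17; 27; 3; 4;
          8; 7; 24; 11; 6; 2; 21; 12; 14]].

Definition J7_K4x28 : seq (seq nat) :=
  [:: [:: 93; 66; 16; 19; 88; 111; 9; 13; 6; 56; 10; 55; 40; 60; 86; 3; 39; 31;
          96; 84; 106; 46; 43; 28; 41; 34; 64; 23]].

Definition J7_K7x28 : seq (seq nat) :=
  [:: [:: 148; 81; 172; 87; 58; 108; 13; 8; 57; 1; 56; 75; 187; 82; 122; 20;
          46; 163; 128; 76; 59; 17; 37; 195; 88; 114; 155; 14];
      [:: 3; 106; 32; 146; 12; 126; 127; 168; 39; 154; 28; 45; 184; 162; 164;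
          187; 20; 50; 74; 55; 57; 175; 89; 185; 133; 0; 9; 43]].

Lemma J7_spectrum n : n = 1 %[mod 84] -> has_design J7 n.
Proof.
by apply: (@spectrum_1_mod_2e _ _ _ 42 _ _ J7_K3x42 _ J7_K85 J7_K169);
  vm_compute.
Qed.

(** [K_28] has [378 = 9 * 42] edges: one base block under a group of order 9. The point 27 is fixed,
    and its three edges in the block lead to the three intervals. *)
Lemma J7_spectrum_28 n : n = 28 %[mod 84] -> has_design J7 n.
Proof.
by apply: (@spectrum_w_mod_3w _ _ _ 42 _ _ J7_K3x42 _ 28 9 3 J7_K28
  J7_K4x28 J7_K7x28); vm_compute.
Qed.

Definition DS_K3x45 : seq (seq nat) :=
  [:: [:: 117; 11; 115; 32; 122; 118; 31; 131; 34; 51; 2; 56; 45; 10; 30; 103;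
          55; 25; 29; 126; 107; 73; 87; 21; 49; 3; 96; 26; 114; 16]].

Definition DS_K91 : seq (seq nat) :=
  [:: [:: 41; 17; 16; 14; 81; 31; 75; 49; 89; 20; 36; 29; 46; 69; 39; 48; 74;
          78; 18; 51; 62; 5; 80; 66; 33; 58; 40; 72; 0; 32]].

Definition DS_K181 : seq (seq nat) :=
  [:: [:: 178; 169; 61; 180; 73; 37; 1; 175; 65; 118; 162; 9; 77; 27; 119; 133;
          94; 32; 145; 130; 36; 103; 49; 125; 123; 151; 172; 153; 154; 86];
      [:: 124; 134; 73; 162; 120; 160; 19; 67; 149; 70; 1; 171; 15; 151; 89;
          174; 157; 65; 40; 117; 141; 147; 26; 22; 165; 154; 10; 11; 30; 5]].

Definition DS_K46 : seq (seq nat) :=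
  [:: [:: 24; 45; 42; 22; 14; 12; 23; 9; 13; 31; 20; 32; 10; 38; 44; 15; 34;
          17; 0; 29; 43; 6; 28; 26; 16; 4; 5; 21; 37; 33]].

Definition DS_K5x45 : seq (seq nat) :=
  [:: [:: 52; 154; 168; 99; 73; 186; 143; 20; 112; 44; 75; 221; 21; 28; 210;
          104; 4; 79; 100; 137; 172; 139; 204; 74; 0; 101; 177; 88; 6; 213];
      [:: 62; 93; 222; 149; 216; 35; 112; 208; 1; 223; 159; 20; 64; 194; 174;
          198; 57; 28; 155; 31; 76; 30; 220; 34; 164; 55; 8; 120; 13; 157]].

Lemma DS_spectrum n : n = 1 %[mod 45] -> has_design DS n.
Proof.
by apply: (@spectrum_1_mod_e _ _ _ 45 _ _ DS_K3x45 _ DS_K91 DS_K181 _ _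
  23 2 DS_K46 DS_K5x45); vm_compute.
Qed.

Definition B31_K3x51 : seq (seq nat) :=
  [:: [:: 46; 35; 63; 96; 74; 55; 108; 82; 133; 89; 84; 48; 19; 91; 92; 95; 52;
          64; 146; 68; 37; 147; 134; 123; 111; 61; 65; 22; 102; 3; 124; 137;
          98; 127]].

Definition B31_K103 : seq (seq nat) :=
  [:: [:: 20; 50; 12; 38; 63; 17; 89; 6; 3; 55; 71; 46; 18; 21; 32; 5; 90; 49;
          51; 7; 24; 13; 9; 14; 0; 77; 48; 81; 45; 2; 44; 15; 39; 62]].

Definition B31_K205 : seq (seq nat) :=
  [:: [:: 186; 100; 156; 146; 93; 194; 88; 31; 39; 201; 141; 124; 89; 11; 187;
          6; 151; 183; 162; 17; 125; 171; 158; 105; 26; 137; 53; 90; 50; 133;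
          64; 129; 22; 122];
      [:: 7; 125; 72; 162; 106; 58; 151; 172; 18; 77; 2; 73; 183; 147; 39; 192;
          117; 116; 59; 134; 105; 142; 136; 80; 12; 79; 56; 10; 165; 156; 203;
          28; 89; 9]].

Definition B31_K52 : seq (seq nat) :=
  [:: [:: 49; 19; 38; 5; 24; 42; 18; 1; 30; 20; 47; 21; 12; 46; 31; 28; 15; 3;
          33; 2; 32; 14; 6; 36; 39; 34; 26; 22; 29; 50; 41; 43; 0; 51];
      [:: 32; 11; 5; 22; 23; 35; 20; 18; 31; 16; 9; 14; 4; 12; 1; 13; 17; 46;
          48; 38; 3; 7; 50; 2; 51; 42; 45; 28; 27; 0; 33; 47; 41; 25]].

Definition B31_K5x51 : seq (seq nat) :=
  [:: [:: 249; 0; 51; 7; 234; 241; 200; 25; 243; 207; 141; 15; 85; 148; 94;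
          108; 238; 100; 189; 110; 68; 129; 171; 126; 173; 27; 151; 6; 219;
          124; 118; 93; 210; 119];
      [:: 103; 47; 9; 210; 160; 238; 54; 3; 193; 115; 116; 12; 148; 126; 179;
          81; 7; 133; 89; 183; 86; 246; 24; 195; 242; 171; 48; 73; 1; 90; 97;
          109; 181; 185]].

Lemma B31_spectrum n : n = 1 %[mod 51] -> has_design B31 n.
Proof.
by apply: (@spectrum_1_mod_e _ _ _ 51 _ _ B31_K3x51 _ B31_K103 B31_K205 _ _
  13 4 B31_K52 B31_K5x51); vm_compute.
Qed.

Definition B32_K3x51 : seq (seq nat) :=
  [:: [:: 48; 126; 10; 145; 85; 73; 81; 36; 133; 62; 60; 116; 31; 150; 125; 30;
          132; 76; 137; 89; 96; 18; 82; 13; 42; 98; 121; 92; 111; 114; 83; 79;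
          65; 54]].

Definition B32_K103 : seq (seq nat) :=
  [:: [:: 58; 32; 99; 31; 76; 3; 20; 84; 43; 6; 19; 97; 24; 22; 94; 75; 93; 89;
          50; 51; 80; 57; 68; 54; 64; 61; 16; 27; 56; 96; 12; 47; 78; 13]].

Definition B32_K205 : seq (seq nat) :=
  [:: [:: 128; 75; 132; 93; 183; 44; 170; 105; 49; 172; 50; 12; 150; 188; 145;
          98; 55; 90; 109; 70; 38; 88; 68; 199; 7; 52; 137; 116; 151; 185; 62;
          2; 82; 156];
      [:: 201; 145; 124; 106; 116; 178; 110; 80; 133; 174; 165; 179; 85; 71;
          130; 61; 120; 10; 3; 190; 191; 151; 126; 13; 19; 24; 79; 22; 117;
          180; 139; 64; 164; 72]].

Definition B32_K52 : seq (seq nat) :=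
  [:: [:: 23; 4; 35; 10; 15; 19; 26; 20; 27; 46; 22; 2; 13; 36; 29; 7; 14; 24;
          17; 44; 48; 37; 49; 21; 11; 41; 43; 39; 40; 33; 25; 5; 12; 1];
      [:: 17; 37; 26; 9; 5; 4; 31; 16; 34; 35; 39; 20; 12; 6; 45; 42; 8; 51;
          27; 30; 3; 38; 15; 0; 32; 22; 41; 48; 47; 43; 18; 33; 11; 40]].

Definition B32_K5x51 : seq (seq nat) :=
  [:: [:: 147; 232; 58; 120; 124; 141; 137; 226; 54; 224; 192; 151; 186; 175;
          13; 94; 231; 150; 228; 107; 85; 136; 77; 206; 213; 12; 45; 10; 182;
          201; 218; 164; 101; 199];
      [:: 250; 141; 37; 16; 78; 129; 151; 217; 190; 206; 64; 218; 172; 180; 1;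
          49; 162; 96; 224; 234; 150; 27; 43; 203; 24; 89; 235; 191; 158; 88;
          199; 95; 71; 138]].

Lemma B32_spectrum n : n = 1 %[mod 51] -> has_design B32 n.
Proof.
by apply: (@spectrum_1_mod_e _ _ _ 51 _ _ B32_K3x51 _ B32_K103 B32_K205 _ _
  13 4 B32_K52 B32_K5x51); vm_compute.
Qed.

Definition Zam_K3x54 : seq (seq nat) :=
  [:: [:: 101; 21; 124; 114; 128; 100; 33; 11; 102; 108; 19; 96; 46; 104; 117;
          64; 158; 88; 7; 59; 28; 68; 25; 27; 52; 149; 63; 151; 143; 106; 140;
          157; 42; 65; 111; 122]].

Definition Zam_K109 : seq (seq nat) :=
  [:: [:: 51; 4; 83; 2; 108; 69; 95; 79; 45; 0; 57; 36; 61; 81; 21; 9; 104; 59;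
          55; 63; 74; 101; 24; 96; 6; 19; 26; 71; 106; 97; 49; 11; 105; 38;
          107; 102]].

(** As [217 = 7 * 31], -1 is not a square, and the second block is not a multiple of this kind. *)
Definition Zam_K217 : seq (seq nat) :=
  [:: [:: 61; 200; 33; 178; 109; 6; 125; 14; 47; 51; 68; 151; 80; 182; 81; 169;
          216; 181; 122; 10; 132; 88; 20; 212; 207; 116; 183; 45; 130; 85; 32;
          26; 66; 159; 34; 154];
      [:: 175; 116; 118; 136; 191; 200; 171; 167; 213; 28; 85; 189; 165; 99;
          73; 62; 35; 71; 102; 162; 131; 204; 61; 192; 172; 13; 20; 150; 187;
          190; 49; 214; 97; 58; 198; 29]].

Lemma Zam_spectrum n : n = 1 %[mod 108] -> has_design Zam n.
Proof.
by apply: (@spectrum_1_mod_2e _ _ _ 54 _ _ Zam_K3x54 _ Zam_K109 Zam_K217);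
  vm_compute.
Qed.

Definition GS5_K3x60 : seq (seq nat) :=
  [:: [:: 77; 145; 91; 32; 12; 69; 63; 5; 141; 143; 66; 97; 35; 13; 42; 68; 34;
          85; 44; 128; 130; 61; 117; 126; 146; 111; 10; 88; 6; 155; 56; 1; 147;
          33; 106; 16; 101; 37; 158; 171]].

Definition GS5_K121 : seq (seq nat) :=
  [:: [:: 53; 97; 28; 64; 12; 46; 32; 105; 29; 58; 119; 49; 106; 27; 36; 67; 8;
          61; 77; 50; 85; 16; 90; 2; 114; 17; 9; 4; 118; 71; 108; 104; 103; 86;
          14; 30; 70; 76; 52; 47]].

Definition GS5_K241 : seq (seq nat) :=
  [:: [:: 66; 164; 68; 193; 121; 56; 94; 221; 53; 3; 143; 65; 159; 157; 30;
          234; 183; 70; 31; 103; 29; 11; 223; 208; 99; 116; 112; 132; 154; 82;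
          172; 156; 54; 202; 62; 236; 220; 209; 125; 168];
      [:: 127; 133; 14; 61; 32; 210; 232; 166; 18; 192; 235; 63; 54; 167; 233;
          34; 144; 142; 56; 85; 169; 222; 53; 57; 70; 194; 179; 13; 216; 187;
          163; 103; 82; 155; 112; 162; 102; 121; 47; 148]].

Definition GS5_K40 : seq (seq nat) :=
  [:: [:: 4; 0; 23; 5; 25; 34; 33; 32; 36; 22; 9; 11; 24; 8; 19; 7; 14; 38; 39;
          35; 20; 16; 18; 29; 17; 13; 10; 30; 3; 6; 37; 15; 28; 26; 31; 2; 1;
          21; 12; 27]].

Definition GS5_K4x40 : seq (seq nat) :=
  [:: [:: 55; 113; 40; 125; 48; 3; 71; 130; 152; 46; 135; 69; 106; 64; 129; 99;
          93; 35; 96; 142; 139; 114; 141; 15; 45; 94; 145; 17; 6; 11; 57; 81;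
          154; 126; 24; 131; 107; 21; 91; 12]].

Definition GS5_K7x40 : seq (seq nat) :=
  [:: [:: 33; 269; 188; 45; 122; 106; 149; 198; 271; 20; 50; 190; 32; 205; 95;
          14; 23; 272; 264; 274; 273; 185; 161; 256; 112; 100; 41; 133; 174;
          155; 87; 209; 261; 13; 229; 15; 27; 8; 105; 25];
      [:: 191; 231; 75; 24; 8; 95; 167; 192; 142; 26; 117; 103; 217; 241; 169;
          54; 41; 47; 279; 93; 124; 212; 238; 186; 221; 69; 240; 243; 45; 183;
          143; 269; 273; 110; 228; 260; 108; 146; 141; 152]].

Lemma GS5_spectrum n : n = 1 %[mod 120] -> has_design GS5 n.
Proof.
by apply: (@spectrum_1_mod_2e _ _ _ 60 _ _ GS5_K3x60 _ GS5_K121 GS5_K241);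
  vm_compute.
Qed.

Lemma GS5_spectrum_40 n : n = 40 %[mod 120] -> has_design GS5 n.
Proof.
by apply: (@spectrum_w_mod_3w _ _ _ 60 _ _ GS5_K3x60 _ 40 13 3 GS5_K40
  GS5_K4x40 GS5_K7x40); vm_compute.
Qed.

Definition Sze_K3x75 : seq (seq nat) :=
  [:: [:: 122; 201; 219; 80; 218; 202; 23; 148; 216; 208; 49; 196; 53; 55; 213;
          15; 95; 125; 133; 198; 60; 58; 94; 110; 149; 54; 3; 163; 112; 147;
          43; 105; 102; 13; 38; 220; 106; 44; 69; 29; 179; 47; 167; 25; 21; 6;
          178; 203; 0; 64]].

Definition Sze_K151 : seq (seq nat) :=
  [:: [:: 67; 31; 114; 21; 28; 0; 133; 16; 95; 125; 98; 73; 143; 130; 57; 107;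
          4; 12; 102; 39; 38; 147; 33; 131; 29; 27; 91; 26; 82; 70; 48; 47;
          119; 54; 136; 11; 112; 22; 23; 150; 129; 123; 138; 53; 97; 63; 137;
          13; 101; 144]].

Definition Sze_K301 : seq (seq nat) :=
  [:: [:: 263; 14; 35; 71; 257; 69; 175; 256; 258; 119; 215; 40; 22; 89; 184;
          84; 207; 250; 23; 100; 235; 136; 132; 112; 218; 46; 204; 25; 72; 272;
          169; 172; 113; 232; 265; 106; 133; 101; 108; 194; 96; 300; 134; 79;
          217; 34; 261; 128; 213; 276];
      [:: 192; 108; 129; 228; 268; 100; 115; 39; 61; 124; 23; 104; 59; 219;
          218; 276; 73; 27; 169; 107; 288; 267; 230; 40; 50; 37; 262; 46; 10;
          204; 133; 298; 259; 194; 231; 60; 269; 261; 200; 18; 242; 185; 155;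
          178; 257; 160; 38; 206; 131; 214]].

Definition Sze_K76 : seq (seq nat) :=
  [:: [:: 53; 51; 60; 18; 71; 19; 39; 8; 37; 20; 35; 10; 69; 38; 31; 67; 1; 32;
          66; 54; 12; 75; 26; 58; 64; 15; 44; 0; 47; 61; 36; 34; 50; 6; 48; 68;
          52; 17; 62; 14; 41; 56; 49; 24; 3; 30; 9; 59; 5; 43];
      [:: 32; 75; 48; 28; 21; 72; 20; 8; 35; 66; 36; 27; 67; 52; 23; 18; 38; 1;
          70; 37; 59; 2; 25; 56; 68; 74; 0; 22; 5; 31; 15; 16; 58; 13; 65; 19;
          61; 39; 57; 6; 40; 46; 26; 11; 44; 73; 10; 51; 50; 55]].

Definition Sze_K5x75 : seq (seq nat) :=
  [:: [:: 205; 106; 307; 115; 324; 88; 327; 236; 161; 320; 314; 97; 359; 315;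
          183; 355; 89; 237; 142; 99; 316; 140; 95; 16; 207; 251; 334; 169;
          310; 226; 215; 223; 53; 285; 52; 230; 47; 13; 198; 120; 347; 284;
          138; 225; 80; 1; 358; 262; 317; 369];
      [:: 78; 341; 72; 197; 218; 121; 31; 45; 5; 24; 120; 71; 105; 13; 199; 42;
          254; 250; 286; 214; 102; 290; 20; 43; 147; 311; 296; 80; 228; 276;
          19; 125; 300; 106; 239; 157; 348; 10; 360; 164; 245; 221; 342; 216;
          145; 138; 313; 201; 316; 159]].

Lemma Sze_spectrum n : n = 1 %[mod 75] -> has_design Sze n.
Proof.
by apply: (@spectrum_1_mod_e _ _ _ 75 _ _ Sze_K3x75 _ Sze_K151 Sze_K301 _ _
  19 4 Sze_K76 Sze_K5x75); vm_compute.
Qed.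

Definition Wat_K3x75 : seq (seq nat) :=
  [:: [:: 60; 112; 141; 44; 210; 175; 22; 135; 71; 124; 23; 164; 156; 76; 110;
          193; 107; 118; 15; 138; 13; 91; 206; 214; 84; 4; 132; 7; 189; 167; 8;
          51; 0; 158; 70; 1; 161; 152; 151; 14; 79; 121; 134; 204; 36; 150; 10;
          104; 169; 111]].

Definition Wat_K151 : seq (seq nat) :=
  [:: [:: 2; 43; 101; 48; 83; 127; 91; 109; 49; 139; 8; 72; 36; 137; 70; 35;
          147; 46; 80; 78; 94; 122; 61; 24; 125; 95; 65; 93; 140; 31; 124; 41;
          121; 66; 123; 102; 105; 25; 126; 110; 22; 5; 0; 120; 86; 133; 84; 53;
          62; 42]].

Definition Wat_K301 : seq (seq nat) :=
  [:: [:: 6; 164; 103; 264; 213; 281; 53; 142; 155; 14; 216; 268; 12; 288; 244;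
          156; 204; 190; 220; 200; 208; 221; 174; 23; 229; 297; 202; 201; 73;
          133; 258; 254; 193; 178; 68; 50; 5; 238; 29; 160; 196; 210; 259; 95;
          283; 66; 64; 293; 63; 261];
      [:: 236; 149; 176; 292; 46; 138; 63; 11; 178; 296; 163; 244; 147; 72; 47;
          225; 156; 152; 283; 79; 209; 91; 213; 88; 58; 125; 70; 93; 173; 10;
          17; 282; 61; 175; 146; 270; 106; 151; 81; 281; 252; 216; 121; 87;
          117; 222; 33; 38; 274; 165]].

Definition Wat_K76 : seq (seq nat) :=
  [:: [:: 74; 67; 24; 18; 58; 19; 56; 4; 28; 22; 44; 75; 60; 73; 30; 54; 72;
          50; 31; 63; 45; 26; 16; 13; 38; 69; 53; 49; 66; 34; 32; 35; 15; 10;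
          3; 17; 27; 42; 6; 2; 21; 11; 9; 64; 48; 51; 43; 36; 41; 61];
      [:: 3; 25; 31; 62; 48; 70; 0; 27; 69; 14; 5; 26; 10; 73; 39; 57; 45; 52;
          47; 8; 29; 74; 4; 15; 32; 20; 1; 65; 42; 63; 35; 68; 51; 11; 22; 55;
          12; 33; 30; 50; 46; 61; 21; 7; 58; 59; 16; 43; 40; 64]].

Definition Wat_K5x75 : seq (seq nat) :=
  [:: [:: 58; 211; 270; 39; 73; 268; 183; 82; 315; 234; 199; 361; 17; 12; 209;
          226; 365; 308; 274; 300; 38; 124; 241; 92; 273; 352; 57; 351; 340;
          206; 254; 305; 322; 239; 202; 133; 31; 20; 188; 356; 276; 218; 11;
          200; 15; 282; 68; 344; 207; 186];
      [:: 76; 138; 141; 20; 292; 128; 318; 301; 127; 234; 353; 341; 28; 270;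
          125; 212; 145; 261; 149; 241; 111; 90; 144; 208; 213; 365; 266; 235;
          226; 24; 104; 136; 34; 232; 229; 186; 274; 193; 110; 333; 316; 302;
          74; 118; 143; 357; 337; 250; 116; 5]].

Lemma Wat_spectrum n : n = 1 %[mod 75] -> has_design Wat n.
Proof.
by apply: (@spectrum_1_mod_e _ _ _ 75 _ _ Wat_K3x75 _ Wat_K151 Wat_K301 _ _
  19 4 Wat_K76 Wat_K5x75); vm_compute.
Qed.

Theorem theorem6 :
  (forall n : nat, n = 1 %[mod 39] ->
     [/\ has_design CS1 n, has_design CS2 n, has_design B21 n
       & has_design B22 n]) /\
  (forall n : nat, n = 1 %[mod 84] \/ n = 28 %[mod 84] ->
     has_design J7 n) /\
  (forall n : nat, n = 1 %[mod 45] -> has_design DS n) /\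
  (forall n : nat, n = 1 %[mod 51] ->
     has_design B31 n /\ has_design B32 n) /\
  (forall n : nat, n = 1 %[mod 108] -> has_design Zam n) /\
  (forall n : nat, n = 1 %[mod 120] \/ n = 40 %[mod 120] ->
     has_design GS5 n) /\
  (forall n : nat, n = 1 %[mod 75] ->
     has_design Sze n /\ has_design Wat n).
Proof.
split; first by move=> n n1; split;
  [apply: CS1_spectrum | apply: CS2_spectrum | apply: B21_spectrum | apply: B22_spectrum].
split; first by move=> n [/J7_spectrum|/J7_spectrum_28].
split; first exact: DS_spectrum.
split; first by move=> n n1; split; [apply: B31_spectrum | apply: B32_spectrum].
split; first exact: Zam_spectrum.
split; first by move=> n [/GS5_spectrum|/GS5_spectrum_40].
by move=> n n1; split; [apply: Sze_spectrum | apply: Wat_spectrum].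
Qed.
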